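(* Let $\Omega$ be a Polish space, $\mathcal{P}$ a weakly relatively compact set of Borel probability measures on $\Omega$, $1\le p<\infty$, and $c_p=c_{p,\mathcal{P}}$. There is a regular Borel probability measure $P$ belonging to the canonical $c_p$-class and a countable subset $\mathcal{D}=\{L_n,\ n\in\mathbb{N}\}$ of the set $L^1(c_p)^*_+$ of non-negative continuous linear forms on $L^1(c_p)$ such that: $\mathcal{D}$ is dense in $L^1(c_p)^*_+=\mathcal{M}^+(c_p)$ for the weak* topology $\sigma(L^1(c_p)^*,L^1(c_p))$; and each $L_n$ is represented by a non-negative Borel measure absolutely continuous with respect to $P$. Every continuous linear form $\Phi$ on $L^1(c_p)$ is the weak* limit of a sequence $\Phi_n$, each $\Phi_n$ being the difference of two elements of $\mathcal{D}$. Furthermore, for every $X\ge0$ in $L^1(c_p)$, $X=0$ iff $P(X)=0$ iff $L_n(X)=0$ for all $n\in\mathbb{N}$.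
   Context: $c_{p,\mathcal{P}}(f)=\sup_{P\in\mathcal{P}}E_P(|f|^p)^{1/p}$ for $f\in\mathcal{C}_b(\Omega)$, extended to all real functions by $c(f)=\sup\{c(\varphi):\varphi\in\mathcal{C}_b(\Omega),0\le\varphi\le f\}$ for $f\ge0$ l.s.c. and $c(g)=\inf\{c(f):f\text{ l.s.c.},f\ge|g|\}$. $L^1(c_p)$ is the quotient by $c_p$-null elements of the $c_p$-closure of $\mathcal{C}_b(\Omega)$ in $\{g:c_p(g)<\infty\}$. Order: $X\ge0$ iff there are $f_n\in\mathcal{C}_b(\Omega)$, $f_n\ge0$, with $c_p(g-f_n)\to0$ for every representative $g$ of $X$; a linear form is non-negative if it is $\ge0$ on such $X$. $\mathcal{M}^+(c_p)$ is the set of finite non-negative Borel measures $\mu$ such that $f\mapsto\int f\,d\mu$ extends to a continuous linear form on $L^1(c_p)$ (value $\mu(X)$). For $\mu,\nu\in\mathcal{M}^+(c_p)$, $\mu\,\mathcal{R}_{c_p}\,\nu$ iff they have the same null sets among non-negative elements of $L^1(c_p)$; the canonical $c_p$-class is the set of $\mu\in\mathcal{M}^+(c_p)$ with: for all $X\ge0$ in $L^1(c_p)$, $\mu(X)=0\iff X=0$. A bounded measure $\mu$ is regular if for every Borel $A$ and $\varepsilon>0$ there are closed $F\subset A\subset G$ open with $|\mu|(G\setminus F)<\varepsilon$. *)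

(* Defs.v *)
From HB Require Import structures.
From mathcomp Require Import all_boot all_order all_algebra.
From mathcomp Require Import all_classical all_reals all_analysis.
Set Implicit Arguments. Unset Strict Implicit. Unset Printing Implicit Defensive.
Import Order.TTheory GRing.Theory Num.Theory.
Import numFieldNormedType.Exports.
Local Open Scope classical_set_scope.
Local Open Scope ring_scope.

Section Defs.
Context {R : realType} {T : ptopologicalType}.

Definition polish : Prop :=
  (exists D : set T, countable D /\ closure D = setT) /\
  exists d : T -> T -> R,
    [/\ (forall x y, 0 <= d x y) /\
        (forall x y, d x y = 0 <-> x = y),
        (forall x y, d x y = d y x),
        (forall x y z, d x z <= d x y + d y z),
        (forall A : set T, open A <->
            forall x, A x -> exists2 e, 0 < e & [set y | d x y < e] `<=` A) &
        (forall u : nat -> T,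
            (forall e, 0 < e -> exists N, forall m n, (N <= m)%N -> (N <= n)%N ->
               d (u m) (u n) < e) ->
            exists l, forall e, 0 < e -> exists N, forall n, (N <= n)%N ->
               d (u n) l < e)].

Definition borelT := g_sigma_algebraType (@open T).

Definition bf (f : T -> R) : borelT -> R := f.

Definition Cb (f : T -> R) : Prop :=
  continuous f /\ exists M : R, forall x, `|f x| <= M.

Definition wnbhs (mu : probability borelT R) (n : nat) (F : nat -> T -> R)
    (e : R) : set (probability borelT R) :=
  [set nu | forall i, (i < n)%N ->
     (`| \int[nu]_x (bf (F i) x)%:E - \int[mu]_x (bf (F i) x)%:E | < e%:E)%E].

Definition weak_open (U : set (probability borelT R)) : Prop :=
  forall mu, U mu -> exists n F e,
    [/\ (forall i, (i < n)%N -> Cb (F i)), 0 < e & wnbhs mu n F e `<=` U].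

Definition weak_compact (K : set (probability borelT R)) : Prop :=
  forall (I : Type) (U : I -> set (probability borelT R)),
    (forall i, weak_open (U i)) -> K `<=` \bigcup_i U i ->
    exists (n : nat) (g : nat -> I), K `<=` \bigcup_(k in `I_n) U (g k).

Definition weak_closure (A : set (probability borelT R)) :
    set (probability borelT R) :=
  [set mu | forall n F e, (forall i, (i < n)%N -> Cb (F i)) -> 0 < e ->
     exists nu, A nu /\ wnbhs mu n F e nu].

Definition weakly_rel_compact (A : set (probability borelT R)) : Prop :=
  weak_compact (weak_closure A).

Definition cCb (Ps : set (probability borelT R)) (p : R) (f : T -> R) : \bar R :=
  ereal_sup [set ((\int[mu]_x (`|bf f x| `^ p)%:E) `^ p^-1)%E | mu in Ps].

Definition clsc (Ps : set (probability borelT R)) (p : R) (f : T -> R) : \bar R :=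
  ereal_sup [set cCb Ps p phi |
    phi in [set phi | Cb phi /\ forall x, 0 <= phi x <= f x]].

Definition cap (Ps : set (probability borelT R)) (p : R) (g : T -> R) : \bar R :=
  ereal_inf [set clsc Ps p f |
    f in [set f : T -> R | lower_semicontinuous (EFin \o f) /\
                           forall x, `|g x| <= f x]].

Section L1.
Variable c : (T -> R) -> \bar R.

(** Representatives of elements of L^1(c): the c-closure of C_b inside {c < oo}. *)
Definition L1 (g : T -> R) : Prop :=
  (c g < +oo)%E /\
  forall e, 0 < e -> exists f, Cb f /\ (c (fun x => (g x - f x)%R) < e%:E)%E.

Definition nonnegL (X : T -> R) : Prop :=
  L1 X /\ exists fn : nat -> T -> R,
    (forall n, Cb (fn n) /\ forall x, 0 <= fn n x) /\
    forall g, L1 g -> c (fun x => (g x - X x)%R) = 0%E ->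
      (fun n => c (fun x => (g x - fn n x)%R)) @ \oo --> (0 : \bar R).

Definition contlin (Phi : (T -> R) -> R) : Prop :=
  (forall a g h, L1 g -> L1 h ->
     Phi (fun x => a * g x + h x) = a * Phi g + Phi h) /\
  (forall g, L1 g -> forall e, 0 < e -> exists2 d, 0 < d &
     forall h, L1 h -> (c (fun x => (h x - g x)%R) < d%:E)%E -> `|Phi h - Phi g| < e).

Definition nonneg_form (Phi : (T -> R) -> R) : Prop :=
  forall X, nonnegL X -> 0 <= Phi X.

Definition represents (mu : {measure set borelT -> \bar R}) (Phi : (T -> R) -> R) : Prop :=
  contlin Phi /\ forall f, Cb f -> (\int[mu]_x (bf f x)%:E = (Phi f)%:E)%E.

Definition Mplus (mu : {measure set borelT -> \bar R}) : Prop :=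
  (mu setT < +oo)%E /\ exists Phi, represents mu Phi.

Definition canonical_class (mu : {measure set borelT -> \bar R}) : Prop :=
  Mplus mu /\ forall Phi, represents mu Phi ->
    forall X, nonnegL X -> (Phi X = 0 <-> c X = 0%E).
End L1.

Definition regular_measure (mu : set borelT -> \bar R) : Prop :=
  forall A : set borelT, measurable A -> forall e, 0 < e ->
    exists F G : set T,
      [/\ closed F, open G, F `<=` A, A `<=` G & (mu (G `\` F) < e%:E)%E].

End Defs.

(* Main.v *)
Require Import Defs.
From HB Require Import structures.
From mathcomp Require Import all_boot all_order all_algebra.
From mathcomp Require Import all_classical all_reals all_analysis.
From mathcomp Require Import measurable_realfun ring lra.
Import Order.TTheory GRing.Theory Num.Theory.
Import numFieldNormedType.Exports.
Local Open Scope classical_set_scope.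
Local Open Scope ring_scope.
Set Implicit Arguments. Unset Strict Implicit. Unset Printing Implicit Defensive.

(** Weak compactness of the closure of [Ps] gives a Dini property: if [u_n] in
    [C_b] decreases pointwise to [0], then [c_p(u_n)] tends to [0].  Everything
    else rests on it.
    - It makes [c_p] subadditive on all functions, since lower semicontinuous
      functions are increasing limits of Lipschitz ones.
    - It makes [L^1(c_p)] separable: in a separable metric space every non-negative
      function of [C_b] is an increasing limit of members of one countable family, so neither
      tightness nor the uniform norm is needed.
    - It makes every non-negative continuous form a Daniell integral, hence a
      measure, obtained here as the outer measure
      [A |-> inf_{G open, A <= G} sup {Phi f | 0 <= f <= 1_G}]; outer regularity is
      built in, and so is monotonicity in [Phi], which yields the absolute
      continuity.
    Separability lets one choose countably many non-negative forms [L_n] that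
    approximate, with a norm bound, every finite set of prescribed values on a
    dense sequence; so every non-negative form is a weak* sequential limit of
    some of them.  [P] represents the normalized sum of [b_n L_n], [b_n > 0].
    If [P(X) = 0] then all [L_n(X)], hence all expectations [E_Q(X)] for [Q] in
    [Ps], vanish; since [X] is a [c_p]-limit of non-negative functions of [C_b],
    this forces [c_p(X) = 0].  A general form is a difference of two
    non-negative ones by the Riesz decomposition on [C_b]. *)

(** * Bounded continuous functions on a metric space *)

Section BoundedContinuous.
Context {R : realType} {T : ptopologicalType}.
Implicit Types (f g h : T -> R) (a k : R).

Lemma Cb_cst a : Cb (fun _ : T => a).
Proof. by split; [move=> x; exact: cvg_cst|exists `|a|]. Qed.

Lemma Cb_lin a f g : Cb f -> Cb g -> Cb (fun x => a * f x + g x).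
Proof.
move=> [cf [Mf bf]] [cg [Mg bg]]; split.
  move=> x; apply: cvgD; last exact: cg.
  by apply: cvgM; [exact: cvg_cst|exact: cf].
exists (`|a| * Mf + Mg) => x; rewrite (le_trans (ler_normD _ _))// lerD//.
by rewrite normrM ler_wpM2l.
Qed.

Lemma CbD f g : Cb f -> Cb g -> Cb (fun x => f x + g x).
Proof.
move=> cf cg; have := Cb_lin 1 cf cg.
by under eq_fun do rewrite mul1r.
Qed.

Lemma CbZ a f : Cb f -> Cb (fun x => a * f x).
Proof.
move=> cf; have := Cb_lin a cf (Cb_cst 0).
by under eq_fun do rewrite addr0.
Qed.

Lemma CbB f g : Cb f -> Cb g -> Cb (fun x => f x - g x).
Proof.
move=> cf cg; have := CbD cf (CbZ (-1) cg).
by under eq_fun do rewrite mulN1r.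
Qed.

Lemma Cb_abs f : Cb f -> Cb (fun x => `|f x|).
Proof.
move=> [cf [M bf]]; split; last by exists M => x; rewrite normr_id.
by move=> x; apply: cvg_norm; exact: cf.
Qed.

Lemma Cb_max f g : Cb f -> Cb g -> Cb (fun x => Num.max (f x) (g x)).
Proof.
move=> cf cg.
have -> : (fun x => Num.max (f x) (g x)) =
          (fun x => 2^-1 * (f x + g x) + 2^-1 * `|f x - g x|).
  by apply/funext => x; rewrite maxr_absE; field.
by apply: Cb_lin; [exact: CbD|apply: CbZ; apply: Cb_abs; exact: CbB].
Qed.

Lemma Cb_min f g : Cb f -> Cb g -> Cb (fun x => Num.min (f x) (g x)).
Proof.
move=> cf cg.
have -> : (fun x => Num.min (f x) (g x)) =
          (fun x => (f x + g x) - Num.max (f x) (g x)).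
  by apply/funext => x; rewrite -(addr_max_min (f x)) addrAC subrr add0r.
by apply: CbB; [exact: CbD|exact: Cb_max].
Qed.

Lemma Cb_bound f : Cb f -> exists2 M : R, 0 < M & forall x, `|f x| <= M.
Proof.
move=> [_ [M bf]]; exists (`|M| + 1); first by rewrite ltr_wpDl.
by move=> x; rewrite (le_trans (bf x))// (le_trans (ler_norm _))// lerDl.
Qed.

(** Since the sequence decreases, one index [n] for each [x] and [e] already gives pointwise
    convergence to 0. *)
Definition decr0 (u : nat -> T -> R) :=
  [/\ forall n, Cb (u n), forall n x, 0 <= u n.+1 x <= u n x &
      forall x e, 0 < e -> exists n, u n x < e].

Lemma decr0_ge0 u n x : decr0 u -> 0 <= u n x.
Proof. by move=> [_ /(_ n x)/andP[h1 h2] _]; exact: le_trans h2. Qed.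

Lemma decr0_le u m n x : decr0 u -> (m <= n)%N -> u n x <= u m x.
Proof.
move=> [_ du _]; elim: n => [|n IH]; first by rewrite leqn0 => /eqP->.
rewrite leq_eqVlt => /predU1P[->//|]; rewrite ltnS => /IH.
by apply: le_trans; have /andP[] := du n x.
Qed.

End BoundedContinuous.

(** * Approximation from below by Lipschitz functions *)

Definition metrizes {R : realType} {T : ptopologicalType} (d : T -> T -> R) :=
  [/\ forall x y, 0 <= d x y, forall x, d x x = 0, forall x y, d x y = d y x,
      forall x y z, d x z <= d x y + d y z &
      forall A : set T, open A <->
        forall x, A x -> exists2 e, 0 < e & [set y | d x y < e] `<=` A].

Section Metric.
Context {R : realType} {T : ptopologicalType} (d : T -> T -> R).
Hypothesis dP : metrizes d.
Implicit Types (f g h : T -> R).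

Let d_ge0 x y : 0 <= d x y. Proof. by case: dP. Qed.
Let dxx x : d x x = 0. Proof. by case: dP. Qed.
Let dsym x y : d x y = d y x. Proof. by case: dP. Qed.
Let dtri x y z : d x z <= d x y + d y z. Proof. by case: dP. Qed.

Lemma metrizes_nbhs x (A : set T) :
  nbhs x A <-> exists2 e, 0 < e & [set y | d x y < e] `<=` A.
Proof.
have [_ _ _ _ dop] := dP; split.
  rewrite nbhsE => -[B [oB Bx] BA].
  by have [e e0 eB] := (dop B).1 oB x Bx; exists e => // y /eB /BA.
move=> [e e0 eA]; rewrite nbhsE; exists [set y | d x y < e] => //.
split; last by rewrite /= dxx.
apply/dop => y /= xye; exists (e - d x y); first by rewrite subr_gt0.
by move=> z /= yz; rewrite (le_lt_trans (dtri x y z))// -ltrBrDl.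
Qed.

Lemma lipschitz_continuous f k : (forall x y, f x <= f y + k * d x y) ->
  continuous f.
Proof.
move=> lf x; apply/cvgrPdist_lt => e e0.
apply/metrizes_nbhs; exists (e / (`|k| + 1)); first by rewrite divr_gt0// ltr_wpDl.
move=> y /=; rewrite ltr_pdivlMr ?ltr_wpDl// => xy.
have kd : k * d x y < e.
  rewrite (le_lt_trans _ xy)// mulrC ler_wpM2l//.
  by rewrite (le_trans (ler_norm _))// lerDl.
rewrite ltr_norml; apply/andP; split.
  by have := lf y x; rewrite dsym; lra.
by have := lf x y; lra.
Qed.

(* Inf-convolution: the largest [k]-Lipschitz function below [min f k]. *)
Definition lipapx f (k : nat) x : R :=
  inf (range (fun y => Num.min (f y) k%:R + k%:R * d x y)).

Section Lipapx.
Variable f : T -> R.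
Hypothesis f0 : forall x, 0 <= f x.

Let S k x := range (fun y => Num.min (f y) k%:R + k%:R * d x y).

Let lbS k x : has_lbound (S k x).
Proof.
exists 0 => _ [y _ <-]; rewrite addr_ge0// ?mulr_ge0//.
by rewrite le_min f0 ler0n.
Qed.

Let S0 k x : S k x !=set0. Proof. by eexists; exists point. Qed.

Lemma lipapx_leP k x y : lipapx f k x <= Num.min (f y) k%:R + k%:R * d x y.
Proof. by apply: (ge_inf (lbS k x)); exists y. Qed.

Lemma lipapx_ge0 k x : 0 <= lipapx f k x.
Proof.
apply: (lb_le_inf (S0 _ _)) => _ [y _ <-]; rewrite addr_ge0// ?mulr_ge0//.
by rewrite le_min f0 ler0n.
Qed.

Lemma lipapx_le k x : lipapx f k x <= f x.
Proof.
by rewrite (le_trans (lipapx_leP k x x))// dxx mulr0 addr0 ge_min lexx.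
Qed.

Lemma lipapx_lek k x : lipapx f k x <= k%:R.
Proof.
by rewrite (le_trans (lipapx_leP k x x))// dxx mulr0 addr0 ge_min lexx orbT.
Qed.

Lemma lipapx_nd k x : lipapx f k x <= lipapx f k.+1 x.
Proof.
apply: (lb_le_inf (S0 _ _)) => _ [y _ <-]; rewrite (le_trans (lipapx_leP k x y))//.
have kk : k%:R <= k.+1%:R :> R by rewrite ler_nat.
rewrite lerD// ?ler_wpM2r// le_min !ge_min lexx/=.
by rewrite kk orbT.
Qed.

Lemma lipapx_homo x : {homo lipapx f ^~ x : m n / (m <= n)%N >-> m <= n}.
Proof. by apply/nondecreasing_seqP => n; exact: lipapx_nd. Qed.

Lemma lipapx_lip k x y : lipapx f k x <= lipapx f k y + k%:R * d x y.
Proof.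
rewrite -lerBlDr; apply: (lb_le_inf (S0 _ _)) => _ [z _ <-].
have := lipapx_leP k x z; have := dtri x y z.
have : 0 <= k%:R :> R by [].
nra.
Qed.

Lemma lipapx_Cb k : Cb (lipapx f k).
Proof.
split; first exact: lipschitz_continuous (lipapx_lip k).
by exists k%:R => x; rewrite ger0_norm ?lipapx_ge0// lipapx_lek.
Qed.

(** On a ball around [x], lower semicontinuity keeps [f] above [f x - e / 2]; off the ball the
    penalty [n * d x y] alone reaches [f x]. With monotonicity, [lipapx f n] increases pointwise to
    [f]. *)
Lemma lipapx_approx x (e : R) : lower_semicontinuous (EFin \o f) -> 0 < e ->
  exists n, f x - e < lipapx f n x.
Proof.
move=> lf e0.
have [|V nV Vf] := lf x (f x - e / 2).
  by rewrite /= lte_fin; lra.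
have [r r0 rV] := (metrizes_nbhs x V).1 nV.
(* The two truncations secure [n * r >= f x], for the points off the ball, and [n >= f x], so that
   cutting [f] at height [n] does no harm inside it. *)
pose n := (Num.truncn (f x / r) + Num.truncn (f x)).+1.
have nfr : f x <= n%:R * r.
  rewrite -ler_pdivrMr// ltW// (lt_le_trans (truncnS_gt _))// ler_nat ltnS.
  exact: leq_addr.
have nf : f x <= n%:R.
  rewrite ltW// (lt_le_trans (truncnS_gt _))// ler_nat ltnS.
  exact: leq_addl.
exists n; apply: (@lt_le_trans _ _ (f x - e / 2)); first lra.
have n0 : 0 <= n%:R :> R by [].
apply: (lb_le_inf (S0 _ _)) => _ [y _ <-]; have [xy|xy] := ltP (d x y) r.
  have := Vf y (rV y xy); rewrite /= lte_fin => fy.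
  have : f x - e / 2 <= Num.min (f y) n%:R by rewrite le_min (ltW fy) /=; lra.
  have := mulr_ge0 n0 (d_ge0 x y); lra.
have : 0 <= Num.min (f y) n%:R by rewrite le_min f0 n0.
have := ler_wpM2l n0 xy; lra.
Qed.

End Lipapx.

(** * Countably many minorants in a separable metric space *)

Section Separable.
Variable D : set T.
Hypotheses (cD : countable D) (dD : closure D = setT).

Lemma dense_sequence : exists a : nat -> T,
  forall x (e : R), 0 < e -> exists i, d x (a i) < e.
Proof.
have [j jinj] := countable_injP _ cD.
(* [get] inverts the injection [j]; at indices outside its image it returns a default point, and
   only indices [j y] with [y] in [D] are called upon. *)
exists (fun n => get [set x | D x /\ j x = n]) => x e e0.
have : closure D x by rewrite dD.
move=> /(_ [set y | d x y < e]) []; first by apply/metrizes_nbhs; exists e.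
move=> y [Dy xy]; exists (j y); case: xgetP => [z _ [Dz jz]|/(_ y)]; last first.
  by case.
by rewrite (jinj z y) ?inE.
Qed.

End Separable.

Section CountableMinorants.
Variable a : nat -> T.
Hypothesis aP : forall x (e : R), 0 < e -> exists i, d x (a i) < e.

(** A cone with apex over [a i], of rational height and integral slope, cut off at 0: four natural
    numbers code it, so there are countably many. *)
Definition bump (c : nat * nat * nat * nat) x : R :=
  let: (i, q, m, r) := c in Num.max 0 (q%:R / m.+1%:R - r%:R * d x (a i)).

Lemma bump_Cb c : Cb (bump c).
Proof.
case: c => -[[i q] m] r; have qm0 : 0 <= q%:R / m.+1%:R :> R by rewrite divr_ge0.
split; last first.
  exists (q%:R / m.+1%:R) => x; rewrite /= ger0_norm ?le_max ?lexx//.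
  by rewrite ge_max qm0 /= gerBl mulr_ge0.
apply: (@lipschitz_continuous _ r%:R) => x y /=.
have r0 : 0 <= r%:R :> R by [].
have h := mulr_ge0 r0 (d_ge0 x y).
have h2 := ler_wpM2l r0 (dtri y x (a i)); rewrite (dsym y x) mulrDr in h2.
rewrite ge_max; apply/andP; split.
  by rewrite addr_ge0// le_max lexx.
rewrite -lerBlDr le_max; apply/orP; right; rewrite -addrA -opprD lerB//; lra.
Qed.

Definition cmax s x : R := foldr (fun c v => Num.max (bump c x) v) 0 s.

Lemma cmax_Cb s : Cb (cmax s).
Proof. by elim: s => [|c s IH]; [exact: Cb_cst|apply: Cb_max => //; exact: bump_Cb]. Qed.

Lemma cmax_ge0 s x : 0 <= cmax s x.
Proof. by elim: s => [|c s IH] //=; rewrite le_max IH orbT. Qed.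

Lemma cmax_ge s c x : c \in s -> bump c x <= cmax s x.
Proof.
elim: s => [|c' s IH] //=; rewrite inE => /predU1P[->|/IH h]; rewrite le_max.
  by rewrite lexx.
by rewrite h orbT.
Qed.

Lemma cmax_le s x v : 0 <= v -> (forall c, c \in s -> bump c x <= v) ->
  cmax s x <= v.
Proof.
move=> v0; elim: s => [|c s IH] //= h; rewrite ge_max h ?mem_head//=.
by apply: IH => c' cs; apply: h; rewrite inE cs orbT.
Qed.

(** [f] exceeds [f x - e / 4] on a ball of radius [r]. A cone of height between [f x - e / 2] and
    [f x - e / 4], centred within [r / 2] of [x] and steep enough to vanish at distance [r / 2] from
    its centre, stays below [f]; a centre close enough to [x] costs at most [e / 4] more at [x]. *)
Lemma bump_approx f x (e : R) : continuous f -> (forall x, 0 <= f x) -> 0 < e ->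
  e <= f x ->
  exists c, (forall y, bump c y <= f y) /\ f x - e < bump c x.
Proof.
move=> cf f0 e0 efx.
have e4 : 0 < e / 4 by lra.
have /cvgrPdist_lt /(_ _ e4) /metrizes_nbhs [r r0 rf] := cf x.
pose m := Num.truncn (4 / e).
have m0 : 0 < m.+1%:R :> R by [].
have me : m.+1%:R^-1 < e / 4.
  by rewrite -invf_div ltf_pV2 ?posrE ?divr_gt0// truncnS_gt.
pose q := Num.truncn (m.+1%:R * (f x - e / 4)).
have /andP[q1 q2] : q%:R <= m.+1%:R * (f x - e / 4) < q.+1%:R.
  by rewrite truncn_itv// mulr_ge0//; lra.
have q1' : q%:R / m.+1%:R <= f x - e / 4 by rewrite ler_pdivrMr// mulrC.
have q2' : f x - e / 2 < q%:R / m.+1%:R.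
  have : f x - e / 4 < (q%:R + 1) / m.+1%:R by rewrite ltr_pdivlMr// mulrC natr1.
  rewrite mulrDl mul1r; move: me; set u := _^-1; set v := q%:R * u; lra.
set v := q%:R / m.+1%:R in q1' q2'.
pose n := Num.truncn (f x / (r / 2)).
have rn : f x <= n.+1%:R * (r / 2).
  by rewrite -ler_pdivrMr ?divr_gt0// ltW// truncnS_gt.
have n0 : 0 < n.+1%:R :> R by [].
have [i] := @aP x (Num.min (r / 2) (e / 4 / n.+1%:R)) ltac:(by rewrite lt_min !divr_gt0).
rewrite lt_min => /andP[xi1]; rewrite ltr_pdivlMr// => xi2.
exists (i, q, m, n.+1); split.
  move=> y /=; rewrite ge_max f0/= -/v.
  have [yi|yi] := ltP (d y (a i)) (r / 2).
    have : d x y < r by have := dtri x (a i) y; rewrite (dsym (a i)); lra.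
    move=> /rf /=; rewrite ltr_norml => /andP[h1 h2].
    have := mulr_ge0 (ltW n0) (d_ge0 y (a i)); lra.
  have := ler_wpM2l (ltW n0) yi; have := f0 y; lra.
by rewrite /= -/v lt_max; apply/orP; right; rewrite [_ * d x _]mulrC; lra.
Qed.

(** Enumerates the finite maxima of bumps; a number that codes no list gives the empty maximum, the
    zero function. *)
Definition minorant n : T -> R := cmax (odflt [::] (unpickle n)).

Lemma minorant_Cb n : Cb (minorant n). Proof. exact: cmax_Cb. Qed.

Lemma minorant_approx f : Cb f -> (forall x, 0 <= f x) ->
  exists g : nat -> nat, decr0 (fun n x => f x - minorant (g n) x).
Proof.
move=> Cf f0.
(* The bumps of code less than [n] that lie below [f]: these lists grow with [n], and every bump
   below [f] enters at some stage. *)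
pose s n := [seq c <- pmap unpickle (iota 0 n) | `[< forall y, bump c y <= f y >]].
have sE n : minorant (pickle (s n)) = cmax (s n) by rewrite /minorant pickleK.
have ssub n c : c \in s n -> c \in s n.+1.
  rewrite !mem_filter => /andP[-> h].
  by rewrite andTb -addn1 iotaD pmap_cat mem_cat h.
have sle n x : cmax (s n) x <= f x.
  apply: cmax_le => // c; rewrite mem_filter => /andP[/asboolP + _].
  exact.
exists (fun n => pickle (s n)); split.
- by move=> n; apply: CbB => //; exact: minorant_Cb.
- move=> n x; rewrite !sE subr_ge0 sle/= lerB//.
  by apply: cmax_le; [exact: cmax_ge0|move=> c /ssub /cmax_ge].
- move=> x e e0; have [fe|fe] := ltP (f x) e.
    by exists 0; rewrite sE (le_lt_trans _ fe)// gerBl cmax_ge0.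
  have [c [cf ce]] := bump_approx Cf.1 f0 e0 fe.
  (* [iota 0 n] stops before [n], hence the successor. *)
  exists (pickle c).+1; rewrite sE ltrBlDr -ltrBlDl (lt_le_trans ce)//.
  apply: cmax_ge; rewrite mem_filter; apply/andP; split; first exact/asboolP.
  rewrite -addn1 iotaD pmap_cat mem_cat; apply/orP; right.
  by rewrite /= add0n pickleK/= mem_head.
Qed.

End CountableMinorants.
End Metric.

(** * Integrals, L^p norms and the capacity on C_b *)

Section Integration.
Context {R : realType} {T : ptopologicalType}.
Implicit Types (f g h : T -> R).

(** Continuity at [x]: as the power is strictly increasing, it suffices that [|f y|] lies between
    the [p]-th roots of [|f x|^p - e] and [|f x|^p + e]; when the first number is negative, the
    lower bound is trivial. *)
Lemma Cb_powR f p : 0 < p -> Cb f -> Cb (fun x => `|f x| `^ p).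
Proof.
move=> p0 Cf; have p0' : 0 <= p := ltW p0.
have pK (t : R) : 0 <= t -> (t `^ p^-1) `^ p = t.
  by move=> t0; rewrite -powRrM mulVf ?gt_eqF// powRr1.
split; last first.
  have [M _ fM] := Cb_bound Cf; exists (M `^ p) => x.
  rewrite ger0_norm ?powR_ge0//; apply: ge0_ler_powR; rewrite ?nnegrE//.
  exact: le_trans (fM x).
have [cf _] := Cb_abs Cf.
move=> x; apply/cvgrPdist_lt => e e0.
set t := `|f x|; pose b := (t `^ p + e) `^ p^-1.
have tp0 : 0 <= t `^ p by exact: powR_ge0.
have tb : t < b.
  rewrite ltNge; apply/negP => bt.
  have := ge0_ler_powR p0' _ _ bt; rewrite !nnegrE powR_ge0 normr_ge0.
  move=> /(_ isT isT); rewrite pK; lra.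
pose a := (t `^ p - e) `^ p^-1.
have ub y : `|f y| < b -> `|f y| `^ p < t `^ p + e.
  move=> yb; rewrite -[_ + e]pK; last lra.
  by apply: gt0_ltr_powR; rewrite ?nnegrE ?powR_ge0.
have nb : \forall y \near x, `|f y| < b by exact: (cvgr_lt t (cf x)).
have [te|te] := ltP (t `^ p) e.
  near=> y; rewrite ltr_distlC.
  have := powR_ge0 (`|f y|) p => h; apply/andP; split; first lra.
  by apply: ub; near: y.
have at_ : a < t.
  rewrite ltNge; apply/negP => ta.
  have := ge0_ler_powR p0' _ _ ta; rewrite !nnegrE powR_ge0 normr_ge0.
  move=> /(_ isT isT); rewrite pK; lra.
have na : \forall y \near x, a < `|f y| by exact: (cvgr_gt t (cf x)).
near=> y; rewrite ltr_distlC; apply/andP; split; last first.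
  by apply: ub; near: y.
rewrite -[X in X < _]pK; last lra.
apply: gt0_ltr_powR; rewrite ?nnegrE ?powR_ge0//.
by near: y.
Unshelve. all: by end_near. Qed.

Lemma Cb_measurable f : continuous f -> measurable_fun setT (bf f).
Proof.
move=> cf; apply: (measurability _ (RGenOInfty.measurableE R)) => //.
move=> _ [_ [a ->] <-]; rewrite setTI; apply: sub_sigma_algebra.
rewrite /= preimage_itvoy.
have -> : [set x | a < bf f x] = f @^-1` [set y | a < y] by [].
by apply: open_comp; [move=> x _; exact: cf|exact: open_gt].
Qed.

Section FiniteMeasure.
Variable mu : {measure set (@borelT T) -> \bar R}.
Hypothesis muoo : (mu setT < +oo)%E.

Lemma Cb_integrable f : Cb f -> mu.-integrable setT (EFin \o bf f).
Proof.
move=> Cf; apply: measurable_bounded_integrable => //.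
  exact: Cb_measurable Cf.1.
have [M M0 fM] := Cb_bound Cf; exists M; split; first exact: num_real.
by move=> y My x _; apply: (le_trans (fM x)); rewrite ltW.
Qed.

Definition Eint f : R := fine (\int[mu]_x (bf f x)%:E)%E.

Lemma EintE f : Cb f -> (\int[mu]_x (bf f x)%:E)%E = (Eint f)%:E.
Proof.
by move=> Cf; rewrite fineK//; apply: integrable_fin_num => //; exact: Cb_integrable.
Qed.

Lemma Eint_lin a f g : Cb f -> Cb g ->
  Eint (fun x => a * f x + g x) = a * Eint f + Eint g.
Proof.
move=> Cf Cg; apply: EFin_inj; rewrite -EintE; last exact: Cb_lin.
rewrite EFinD EFinM -!EintE//.
under eq_integral do rewrite /bf EFinD EFinM.
have iaf : mu.-integrable setT (fun x => a%:E * (bf f x)%:E)%E.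
  exact: integrableZl (Cb_integrable Cf).
rewrite (integralD _ iaf (Cb_integrable Cg))//.
by rewrite (integralZl _ (Cb_integrable Cf)).
Qed.

Lemma Eint_ge0 f : (forall x, 0 <= f x) -> 0 <= Eint f.
Proof.
by move=> f0; apply: fine_ge0; apply: integral_ge0 => x _; rewrite lee_fin.
Qed.

Lemma Eint_le f g : Cb f -> Cb g -> (forall x, f x <= g x) -> Eint f <= Eint g.
Proof.
move=> Cf Cg fg; rewrite -subr_ge0.
have -> : Eint g - Eint f = Eint (fun x => (-1) * f x + g x).
  by rewrite Eint_lin// mulN1r addrC.
by apply: Eint_ge0 => x; rewrite mulN1r addrC subr_ge0.
Qed.

Lemma Eint_decr0 u e : decr0 u -> 0 < e -> exists n, Eint (u n) < e.
Proof.
move=> du e0; have [Cu ud ulim] := du.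
have [] := @dominated_convergence _ _ R mu setT measurableT
  (fun n x => (bf (u n) x)%:E) (cst 0%E) (fun x => (bf (u 0%N) x)%:E).
- by move=> n; apply/measurable_EFinP; exact: Cb_measurable (Cu n).1.
- exact: measurable_cst.
- apply: aeW => x _; apply/cvg_EFin; first by exists 0%N.
  apply/cvgrPdist_lt => r r0; have [n ur] := ulim x r r0.
  exists n => // m /= nm; rewrite sub0r normrN ger0_norm ?(decr0_ge0 _ _ du)//.
  by rewrite (le_lt_trans _ ur)// (decr0_le _ du nm).
- exact: Cb_integrable.
- apply: aeW => x n _; rewrite abse_EFin lee_fin ger0_norm ?(decr0_ge0 _ _ du)//.
  exact: (decr0_le _ du).
move=> _ _; rewrite integral0 => /fine_cvgP[_] /cvgrPdist_lt/(_ e e0)[n _ /(_ n)].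
move=> /(_ (leqnn n)); rewrite /= sub0r normrN => h; exists n.
by rewrite (le_lt_trans _ h)// ler_norm.
Qed.

End FiniteMeasure.
End Integration.

Section LpNorm.
Context {R : realType} {T : ptopologicalType}.
Variables (p : R).
Hypothesis p1 : 1 <= p.
Implicit Types (f g h : T -> R).

Let p0 : 0 < p. Proof. exact: lt_le_trans p1. Qed.
Let pV0 : 0 <= p^-1. Proof. by rewrite invr_ge0 ltW. Qed.

Section OneMeasure.
Variable mu : probability (@borelT T) R.

Let muoo : (mu setT < +oo)%E.
Proof. by rewrite probability_setT ltry. Qed.

Definition nrm f : R := Eint mu (fun x => `|f x| `^ p) `^ p^-1.

Lemma nrm_ge0 f : 0 <= nrm f. Proof. exact: powR_ge0. Qed.

Lemma nrmE f : Cb f ->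
  ((\int[mu]_x (`|bf f x| `^ p)%:E) `^ p^-1)%E = (nrm f)%:E.
Proof.
move=> Cf; have -> : (fun x => (`|bf f x| `^ p)%:E)
                   = (fun x => (bf (fun x => `|f x| `^ p) x)%:E) by [].
by rewrite (EintE muoo)// ?poweR_EFin//; exact: Cb_powR.
Qed.

Lemma nrm_Lnorm f : Cb f -> (nrm f)%:E = ('N[mu]_p%:E[EFin \o bf f])%E.
Proof.
by move=> Cf; rewrite -nrmE// unlock.
Qed.

Lemma nrmD f g : Cb f -> Cb g -> nrm (fun x => f x + g x) <= nrm f + nrm g.
Proof.
move=> Cf Cg; rewrite -lee_fin EFinD [leLHS](nrm_Lnorm (CbD Cf Cg)).
rewrite [X in (_ <= X + _)%E](nrm_Lnorm Cf) [X in (_ <= _ + X)%E](nrm_Lnorm Cg).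
exact: (minkowski_EFin mu (Cb_measurable Cf.1) (Cb_measurable Cg.1) p1).
Qed.

Lemma nrm_le f g : Cb f -> Cb g -> (forall x, `|f x| <= `|g x|) ->
  nrm f <= nrm g.
Proof.
move=> Cf Cg fg; apply: ge0_ler_powR => //; rewrite ?nnegrE ?Eint_ge0//.
apply: (Eint_le muoo); [exact: Cb_powR|exact: Cb_powR|].
by move=> x; apply: ge0_ler_powR; rewrite ?nnegrE ?fg ?(ltW p0).
Qed.

Lemma Eint_cst a : Eint mu (fun=> a) = a.
Proof.
have h : (\int[mu]_x a%:E = a%:E * 1)%E.
  rewrite (@integral_cst _ _ _ mu setT measurableT a%:E); congr (_ * _)%E.
  exact: probability_setT.
by rewrite /Eint /bf [X in fine X]h mule1.
Qed.

Lemma Eint_Z a f : Cb f -> Eint mu (fun x => a * f x) = a * Eint mu f.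
Proof.
move=> Cf; have := Eint_lin muoo a Cf (Cb_cst 0).
by under eq_fun do rewrite addr0; rewrite Eint_cst addr0.
Qed.

Lemma nrmZ a f : Cb f -> nrm (fun x => a * f x) = `|a| * nrm f.
Proof.
move=> Cf; rewrite /nrm; under eq_fun do rewrite normrM powRM//.
rewrite Eint_Z; last exact: Cb_powR.
rewrite powRM ?powR_ge0 ?Eint_ge0//.
by rewrite -powRrM mulfV ?gt_eqF// powRr1.
Qed.

Lemma nrm_bound f M : Cb f -> 0 <= M -> (forall x, `|f x| <= M) -> nrm f <= M.
Proof.
move=> Cf M0 fM; have : nrm f <= nrm (fun=> M).
  apply: nrm_le => //; first exact: Cb_cst.
  by move=> x; rewrite (ger0_norm M0).
by rewrite /nrm Eint_cst ger0_norm// -powRrM mulfV ?gt_eqF// powRr1.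
Qed.

Lemma Eint_le_nrm f : Cb f -> `|Eint mu f| <= nrm f.
Proof.
move=> Cf; have Caf := Cb_abs Cf.
apply: (@le_trans _ _ (Eint mu (fun x => `|f x|))).
  rewrite ler_norml -[- _]mulN1r -Eint_Z//; apply/andP; split.
    apply: (Eint_le muoo) => // [|x]; first exact: CbZ.
    by rewrite mulN1r lerNl -normrN ler_norm.
  by apply: (Eint_le muoo) => // x; exact: ler_norm.
rewrite -lee_fin [leRHS](nrm_Lnorm Cf) -(EintE muoo)//.
have mf : measurable_fun setT (bf f) by exact: Cb_measurable Cf.1.
(* For [p > 1] this is Hoelder's inequality against the constant 1; for [p = 1] the conjugate
   exponent would be infinite, but the two sides coincide. *)
move: (p1); rewrite le_eqVlt => /predU1P[<-|pgt1].
  by rewrite Lnorm1.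
have m1 : measurable_fun setT (fun _ : @borelT T => 1 : R) by exact: measurable_cst.
pose q := (1 - p^-1)^-1.
have q0 : 0 < q by rewrite invr_gt0 subr_gt0 invf_lt1.
have pq : p^-1 + q^-1 = 1 by rewrite invrK addrC subrK.
have := hoelder mu mf m1 p0 q0 pq.
have -> : ('N[mu]_q%:E[EFin \o (fun=> 1%R)] = 1)%E.
  rewrite [LHS]Lnorm_cst1 -[RHS](poweR1r q^-1); congr (_ `^ _)%E.
  exact: probability_setT.
rewrite Lnorm1 mule1; apply: le_trans.
by under [leRHS]eq_integral do rewrite /= mulr1.
Qed.

(** On [[0, K]] one has [t ^ p <= K ^ (p - 1) * t], so for functions bounded by [K] a small
    expectation forces a small L^p norm. This leads back from linear forms to [c_p] in [cap_eq0]. *)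
Lemma nrm_small K e : 0 < K -> 0 < e -> exists2 r, 0 < r &
  forall f, Cb f -> (forall x, 0 <= f x <= K) -> Eint mu f <= r -> nrm f <= e.
Proof.
move=> K0 e0; have Kp : 0 < K `^ (p - 1) by exact: powR_gt0.
exists (e `^ p / K `^ (p - 1)); first by rewrite divr_gt0// powR_gt0.
move=> f Cf f0K; rewrite ler_pdivlMr// mulrC -Eint_Z// => fr.
have -> : e = (e `^ p) `^ p^-1 by rewrite -powRrM mulfV ?gt_eqF// powRr1// ltW.
apply: ge0_ler_powR => //; rewrite ?nnegrE ?powR_ge0 ?Eint_ge0//.
apply: (le_trans _ fr); apply: (Eint_le muoo); [exact: Cb_powR|exact: CbZ|].
move=> x; have /andP[fx0 fxK] := f0K x; rewrite ger0_norm// -mulr_powRB1// mulrC.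
rewrite ler_wpM2r//; apply: ge0_ler_powR; rewrite ?nnegrE ?subr_ge0//.
exact: ltW.
Qed.

End OneMeasure.

(** * The capacity on C_b and its Dini property *)

Section Capacity.
Variable Ps : set (probability (@borelT T) R).
Hypotheses (Ps0 : Ps !=set0).

Lemma cCb_leP f x : Cb f ->
  (cCb Ps p f <= x)%E <-> forall mu, Ps mu -> ((nrm mu f)%:E <= x)%E.
Proof.
move=> Cf; split.
  move=> /ereal_supP h mu Pmu; rewrite -nrmE//; apply: h; by exists mu.
by move=> h; apply: ge_ereal_sup => _ [mu Pmu <-]; rewrite nrmE//; exact: h.
Qed.

Lemma cCb_ge f mu : Cb f -> Ps mu -> ((nrm mu f)%:E <= cCb Ps p f)%E.
Proof. by move=> Cf; exact: (cCb_leP _ Cf).1. Qed.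

Lemma cCb_ge0 f : Cb f -> (0 <= cCb Ps p f)%E.
Proof.
move=> Cf; have [mu Pmu] := Ps0.
by apply: (le_trans _ (cCb_ge Cf Pmu)); rewrite lee_fin nrm_ge0.
Qed.

Lemma cCb_le f g : Cb f -> Cb g -> (forall x, `|f x| <= `|g x|) ->
  (cCb Ps p f <= cCb Ps p g)%E.
Proof.
move=> Cf Cg fg; apply/cCb_leP => // mu Pmu; apply: (le_trans _ (cCb_ge Cg Pmu)).
by rewrite lee_fin; exact: nrm_le.
Qed.

Lemma cCbD f g : Cb f -> Cb g ->
  (cCb Ps p (fun x => (f x + g x)%R) <= cCb Ps p f + cCb Ps p g)%E.
Proof.
move=> Cf Cg; apply/cCb_leP => [|mu Pmu]; first exact: CbD.
apply: (@le_trans _ _ ((nrm mu f)%:E + (nrm mu g)%:E)%E).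
  by rewrite -EFinD lee_fin; exact: nrmD.
by apply: leeD; exact: cCb_ge.
Qed.

Lemma cCbZ_le a f : Cb f ->
  (cCb Ps p (fun x => (a * f x)%R) <= `|a|%:E * cCb Ps p f)%E.
Proof.
move=> Cf; apply/cCb_leP => [|mu Pmu]; first exact: CbZ.
by rewrite nrmZ// EFinM lee_wpmul2l ?lee_fin//; exact: cCb_ge.
Qed.

Lemma cCb_bound f M : Cb f -> 0 <= M -> (forall x, `|f x| <= M) ->
  (cCb Ps p f <= M%:E)%E.
Proof.
move=> Cf M0 fM; apply/cCb_leP => // mu Pmu.
by rewrite lee_fin; exact: nrm_bound.
Qed.

Lemma subset_weak_closure : Ps `<=` weak_closure Ps.
Proof.
move=> mu Pmu n F e CF e0; exists mu; split => // i i_n.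
have muoo : (mu setT < +oo)%E by rewrite probability_setT ltry.
by rewrite (EintE muoo (CF i i_n)) -EFinB subrr/= normr0 lte_fin.
Qed.

Lemma weak_open_Eint_lt f e : Cb f ->
  weak_open [set mu : probability (@borelT T) R | Eint mu f < e].
Proof.
move=> Cf mu /= mue; exists 1%N, (fun=> f), (e - Eint mu f).
split; [by []|by rewrite subr_gt0|].
have poo (nu : probability (@borelT T) R) : (nu setT < +oo)%E.
  by rewrite probability_setT ltry.
move=> nu /(_ 0%N isT); rewrite !(EintE (poo _) Cf) -EFinB/= lte_fin.
by move=> /(le_lt_trans (ler_norm _)); lra.
Qed.

(** Dini's argument on the space of measures: the sets where [E(u_n^p) < (e / 2)^p] are weakly open,
    increase with [n], and cover the weak closure by dominated convergence, so a finite subcover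
    yields one [n] for all of [Ps]. *)
Lemma cCb_decr0 u e : weakly_rel_compact Ps -> decr0 u -> 0 < e ->
  exists n, (cCb Ps p (u n) < e%:E)%E.
Proof.
move=> cPs du e0; have [Cu ud ulim] := du.
have e20 : 0 < e / 2 by rewrite divr_gt0.
pose w n x := `|u n x| `^ p.
have u0 n x : 0 <= u n x by exact: decr0_ge0 du.
have wle n m x : (n <= m)%N -> w m x <= w n x.
  move=> nm; apply: (ge0_ler_powR (ltW p0)); rewrite ?nnegrE// !ger0_norm//.
  exact: (decr0_le _ du nm).
have dw : decr0 w.
  split; first by move=> n; exact: Cb_powR.
    by move=> n x; rewrite powR_ge0/= wle.
  move=> x r r0; have [n un] := ulim x (r `^ p^-1) ltac:(by rewrite powR_gt0).
  exists n; rewrite /w ger0_norm//.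
  have -> : r = (r `^ p^-1) `^ p by rewrite -powRrM mulVf ?gt_eqF// powRr1// ltW.
  by apply: gt0_ltr_powR; rewrite ?nnegrE ?powR_ge0.
have := cPs nat (fun n => [set mu | Eint mu (w n) < (e / 2) `^ p]).
move=> [n||].
- by apply: weak_open_Eint_lt; exact: Cb_powR.
- move=> mu _.
  have muoo : (mu setT < +oo)%E by rewrite probability_setT ltry.
  have [n wn] := Eint_decr0 muoo dw (powR_gt0 p e20).
  by exists n.
(* [N] is the largest index of the subcover. A supremum over [Ps] preserves only [<=], and [e / 2]
   leaves room for the strict inequality. *)
move=> k [g gP]; pose N := (\max_(i < k) g i)%N.
exists N; apply: (@le_lt_trans _ _ (e / 2)%:E); last by rewrite lte_fin; lra.
apply/cCb_leP => // mu Pmu; rewrite lee_fin.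
have [i ik /= /ltW mugi] := gP mu (subset_weak_closure Pmu).
have muoo : (mu setT < +oo)%E by rewrite probability_setT ltry.
have -> : e / 2 = ((e / 2) `^ p) `^ p^-1.
  by rewrite -powRrM mulfV ?gt_eqF// powRr1// ltW.
rewrite /nrm; apply: (ge0_ler_powR pV0); rewrite ?nnegrE; [exact: Eint_ge0|exact: powR_ge0|].
apply: (le_trans _ mugi); apply: (Eint_le muoo); [exact: Cb_powR|exact: Cb_powR|].
move=> x; apply: wle; exact: (@leq_bigmax _ (fun i : 'I_k => g i) (Ordinal ik)).
Qed.

End Capacity.
End LpNorm.

(** * The capacity on arbitrary functions *)

Section UpperCapacity.
Context {R : realType} {T : ptopologicalType}.
Implicit Types (f g h : T -> R).

Local Notation lsc f := (lower_semicontinuous (EFin \o f)).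

Lemma lscP f : lsc f <-> forall x a, a < f x -> \forall y \near x, a < f y.
Proof.
split=> [lf x a ax|lf x a].
  have [|V nV Vf] := lf x a; first by rewrite /= lte_fin.
  by apply: filterS nV => y /Vf; rewrite /= lte_fin.
by rewrite /= lte_fin => /lf h; exists [set y | a < f y].
Qed.

Lemma continuous_lsc f : continuous f -> lsc f.
Proof. by move=> cf; apply/lscP => x a ax; exact: (cvgr_gt (f x) (cf x)). Qed.

Lemma lscD f g : lsc f -> lsc g -> lsc (fun x => f x + g x).
Proof.
move=> /lscP lf /lscP lg; apply/lscP => x a ax.
pose e := (f x + g x - a) / 2.
have e0 : 0 < e by rewrite divr_gt0// subr_gt0.
have h1 : \forall y \near x, f x - e < f y by apply: lf; rewrite gtrBl.
have h2 : \forall y \near x, g x - e < g y by apply: lg; rewrite gtrBl.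
near=> y; have u1 : f x - e < f y by near: y.
have u2 : g x - e < g y by near: y.
by rewrite /e in u1 u2; lra.
Unshelve. all: by end_near. Qed.

Lemma lscZ a f : 0 < a -> lsc f -> lsc (fun x => a * f x).
Proof.
move=> a0 /lscP lf; apply/lscP => x b bx.
have : \forall y \near x, b / a < f y by apply: lf; rewrite ltr_pdivrMr// mulrC.
by apply: filterS => y; rewrite ltr_pdivrMr// mulrC.
Qed.

Variables (d : T -> T -> R) (p : R) (Ps : set (probability (@borelT T) R)).
Hypotheses (dP : metrizes d) (p1 : 1 <= p) (Ps0 : Ps !=set0).
Hypothesis cPs : weakly_rel_compact Ps.

Lemma clsc_ge f phi : Cb phi -> (forall x, 0 <= phi x <= f x) ->
  (cCb Ps p phi <= clsc Ps p f)%E.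
Proof. by move=> Cphi phif; apply: ereal_sup_ubound; exists phi. Qed.

Lemma clsc_ge0 f : (forall x, 0 <= f x) -> (0 <= clsc Ps p f)%E.
Proof.
move=> f0; apply: (@le_trans _ _ (cCb Ps p (fun=> 0))).
  by apply: cCb_ge0 => //; exact: Cb_cst.
by apply: clsc_ge; [exact: Cb_cst|move=> x; rewrite lexx f0].
Qed.

Lemma clscZ_le a f : 0 < a -> (clsc Ps p (fun x => (a * f x)%R) <= a%:E * clsc Ps p f)%E.
Proof.
move=> a0; apply: ge_ereal_sup => _ [phi [Cphi phif] <-].
have -> : phi = (fun x => a * (a^-1 * phi x)).
  by apply/funext => x; rewrite mulVKf// gt_eqF.
have Cphi' := CbZ a^-1 Cphi.
apply: (le_trans (cCbZ_le p1 Ps a Cphi')); rewrite gtr0_norm//.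
apply: lee_wpmul2l; first by rewrite lee_fin ltW.
apply: clsc_ge => // x; have /andP[phi0 phix] := phif x.
rewrite ler_pdivrMl// phix andbT mulr_ge0//.
by rewrite invr_ge0 ltW.
Qed.

(** Truncating [phi <= f + g] by the sums [fn n + gn n] of Lipschitz minorants gives functions that
    increase to [phi]; by the Dini property the remainder has arbitrarily small capacity. *)
Lemma clscD f g : (forall x, 0 <= f x) -> (forall x, 0 <= g x) -> lsc f -> lsc g ->
  (clsc Ps p (fun x => (f x + g x)%R) <= clsc Ps p f + clsc Ps p g)%E.
Proof.
move=> f0 g0 lf lg; apply: ge_ereal_sup => _ [phi [Cphi phifg] <-].
pose fn := lipapx d f; pose gn := lipapx d g.
have Cf n : Cb (fn n) by exact: lipapx_Cb.
have Cg n : Cb (gn n) by exact: lipapx_Cb.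
have fn0 n x : 0 <= fn n x by exact: lipapx_ge0.
have gn0 n x : 0 <= gn n x by exact: lipapx_ge0.
pose psi n x := Num.min (phi x) (fn n x + gn n x).
have Cpsi n : Cb (psi n) by apply: Cb_min => //; exact: CbD.
have dpsi : decr0 (fun n x => phi x - psi n x).
  split; first by move=> n; exact: CbB.
    move=> n x; rewrite subr_ge0 ge_min lexx/= lerB//.
    rewrite le_min !ge_min lexx/=; apply/orP; right.
    by apply: lerD; exact: lipapx_nd.
  move=> x e e0; have e20 : 0 < e / 2 by rewrite divr_gt0.
  have [n1 h1] := lipapx_approx dP f0 x lf e20.
  have [n2 h2] := lipapx_approx dP g0 x lg e20.
  exists (maxn n1 n2); rewrite ltrBlDr -ltrBlDl lt_min.
  have u1 := lipapx_homo dP f0 x (leq_maxl n1 n2).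
  have u2 := lipapx_homo dP g0 x (leq_maxr n1 n2).
  have /andP[_ pfg] := phifg x; rewrite /fn /gn.
  by apply/andP; split; lra.
apply/lee_addgt0Pr => e e0.
have [n ne] := cCb_decr0 p1 cPs dpsi e0.
have phiE : phi = (fun x => psi n x + (phi x - psi n x)).
  by apply/funext => x; rewrite addrC subrK.
rewrite {1}phiE (le_trans (cCbD p1 _ (Cpsi n) (CbB Cphi (Cpsi n))))//.
apply: leeD; last exact: ltW.
have psi0 x : 0 <= psi n x.
  by rewrite le_min addr_ge0// andbT; have /andP[] := phifg x.
apply: (@le_trans _ _ (cCb Ps p (fun x => fn n x + gn n x))).
  apply: cCb_le => // [|x]; first exact: CbD.
  by rewrite !ger0_norm ?addr_ge0// ge_min lexx orbT.
apply: (le_trans (cCbD p1 _ (Cf n) (Cg n))); apply: leeD.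
  by apply: clsc_ge => // x; rewrite fn0; exact: lipapx_le.
by apply: clsc_ge => // x; rewrite gn0; exact: lipapx_le.
Qed.

Lemma cap_leP g f : lsc f -> (forall x, `|g x| <= f x) ->
  (cap Ps p g <= clsc Ps p f)%E.
Proof. by move=> lf gf; apply: ereal_inf_lbound; exists f. Qed.

Lemma cap_ge0 g : (0 <= cap Ps p g)%E.
Proof.
apply: le_ereal_inf_tmp => _ [f [lf gf] <-]; apply: clsc_ge0 => x.
by apply: le_trans (gf x).
Qed.

Lemma cap_le g h : (forall x, `|g x| <= `|h x|) -> (cap Ps p g <= cap Ps p h)%E.
Proof.
move=> gh; apply: le_ereal_inf_tmp => _ [f [lf hf] <-]; apply: cap_leP => // x.
exact: le_trans (hf x).
Qed.

Lemma cap_Cb f : Cb f -> cap Ps p f = cCb Ps p f.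
Proof.
move=> Cf; have Caf := Cb_abs Cf; apply/eqP; rewrite eq_le; apply/andP; split.
  apply: (@le_trans _ _ (clsc Ps p (fun x => `|f x|))).
    by apply: cap_leP => //; exact: continuous_lsc Caf.1.
  apply: ge_ereal_sup => _ [phi [Cphi phif] <-].
  apply: cCb_le => // x; have /andP[phi0 phix] := phif x.
  by rewrite ger0_norm.
apply: le_ereal_inf_tmp => _ [h [lh fh] <-].
apply: (@le_trans _ _ (cCb Ps p (fun x => `|f x|))).
  by apply: cCb_le => // x; rewrite normr_id.
by apply: clsc_ge => // x; rewrite fh andbT.
Qed.

Lemma capZ_le a g : (cap Ps p (fun x => (a * g x)%R) <= `|a|%:E * cap Ps p g)%E.
Proof.
have [->|a0] := eqVneq a 0.
  rewrite normr0 mul0e; under eq_fun do rewrite mul0r.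
  rewrite cap_Cb; last exact: Cb_cst.
  by apply: cCb_bound => //; [exact: Cb_cst|move=> x; rewrite normr0].
have na0 : 0 < `|a| by rewrite normr_gt0.
rewrite -lee_pdivrMl//; apply: le_ereal_inf_tmp => _ [f [lf gf] <-].
rewrite lee_pdivrMl//; apply: (le_trans _ (clscZ_le _ na0)).
by apply: cap_leP => [|x]; [exact: lscZ|rewrite normrM ler_wpM2l].
Qed.

Lemma capD g h : (cap Ps p (fun x => (g x + h x)%R) <= cap Ps p g + cap Ps p h)%E.
Proof.
have g0 := cap_ge0 g; have h0 := cap_ge0 h.
have [gfin|] := boolP (cap Ps p g \is a fin_num); last first.
  rewrite ge0_fin_numE// -leNgt leye_eq => /eqP ->.
  by rewrite addye ?leey// gt_eqF// (lt_le_trans _ h0).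
have [hfin|] := boolP (cap Ps p h \is a fin_num); last first.
  rewrite ge0_fin_numE// -leNgt leye_eq => /eqP ->.
  by rewrite addey ?leey// gt_eqF// (lt_le_trans _ g0).
apply/lee_addgt0Pr => e e0; have e20 : 0 < e / 2 by rewrite divr_gt0.
have [_ [f1 [lf1 gf1] <-] c1] := lb_ereal_inf_adherent e20 gfin.
have [_ [f2 [lf2 hf2] <-] c2] := lb_ereal_inf_adherent e20 hfin.
apply: (@le_trans _ _ (clsc Ps p (fun x => f1 x + f2 x))).
  apply: cap_leP; first exact: lscD.
  by move=> x; rewrite (le_trans (ler_normD _ _))// lerD.
apply: (@le_trans _ _ (clsc Ps p f1 + clsc Ps p f2)).
  by apply: clscD => // x; [exact: le_trans (gf1 x)|exact: le_trans (hf2 x)].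
rewrite (splitr e) EFinD addeACA; apply: leeD; exact: ltW.
Qed.

Lemma cap_Cb_lty f : Cb f -> (cap Ps p f < +oo)%E.
Proof.
move=> Cf; have [M M0 fM] := Cb_bound Cf; rewrite cap_Cb//.
by rewrite (le_lt_trans (cCb_bound p1 _ Cf (ltW M0) fM))// ltry.
Qed.

Lemma cap_decr0 u e : decr0 u -> 0 < e -> exists n, (cap Ps p (u n) < e%:E)%E.
Proof.
move=> du e0; have [n un] := cCb_decr0 p1 cPs du e0.
by exists n; rewrite cap_Cb//; case: du.
Qed.

End UpperCapacity.

(** * Continuous linear forms on L^1(c) *)

(** What the theory of forms below uses of [c_p]: a monotone extended seminorm on all functions,
    finite on C_b, with the Dini property [capacity_decr0]. *)
Record capacity {R : realType} {T : ptopologicalType}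
  (c : (T -> R) -> \bar R) : Prop := Capacity {
  capacity_ge0 : forall g, (0 <= c g)%E;
  capacity_le : forall g h, (forall x, `|g x| <= `|h x|) -> (c g <= c h)%E;
  capacityZ : forall a g, (c (fun x => (a * g x)%R) <= `|a|%:E * c g)%E;
  capacityD : forall g h, (c (fun x => (g x + h x)%R) <= c g + c h)%E;
  capacity_Cb : forall f, Cb f -> (c f < +oo)%E;
  capacity_decr0 : forall u e, decr0 u -> 0 < e -> exists n, (c (u n) < e%:E)%E }.

Section CapacityL1.
Context {R : realType} {T : ptopologicalType} (c : (T -> R) -> \bar R).
Hypothesis cP : capacity c.
Implicit Types (f g h X : T -> R) (Phi : (T -> R) -> R).

Definition csn g : R := fine (c g).

Lemma capacity0 : c (fun=> 0) = 0%E.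
Proof.
apply/eqP; rewrite eq_le (capacity_ge0 cP) andbT.
have := capacityZ cP 0 (fun=> 0); rewrite normr0 mul0e.
by under eq_fun do rewrite mul0r.
Qed.

Lemma csn_ge0 g : 0 <= csn g.
Proof. by apply: fine_ge0; exact: capacity_ge0. Qed.

Lemma L1_Cb f : Cb f -> L1 c f.
Proof.
move=> Cf; split; first exact: capacity_Cb.
move=> e e0; exists f; split => //.
by under eq_fun do rewrite subrr; rewrite capacity0 lte_fin.
Qed.

Lemma L1_csn g : L1 c g -> c g = (csn g)%:E.
Proof. by move=> [g1 _]; rewrite fineK// ge0_fin_numE// (capacity_ge0 cP). Qed.

Lemma capacity_opp g : c (fun x => - g x) = c g.
Proof.
by apply/eqP; rewrite eq_le !(capacity_le cP)// => x; rewrite normrN.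
Qed.

Lemma csn_opp g : csn (fun x => - g x) = csn g.
Proof. by rewrite /csn capacity_opp. Qed.

Lemma csn_distC g h : csn (fun x => g x - h x) = csn (fun x => h x - g x).
Proof. by rewrite -csn_opp; under eq_fun do rewrite opprB. Qed.

Lemma L1_lin a g h : L1 c g -> L1 c h -> L1 c (fun x => a * g x + h x).
Proof.
move=> [g1 gd] [h1 hd]; split.
  apply: (le_lt_trans (capacityD cP _ _)); rewrite lte_add_pinfty//.
  apply: (le_lt_trans (capacityZ cP _ _)); rewrite lte_mul_pinfty//.
move=> e e0; have e1 : 0 < e / 4 / (`|a| + 1) by rewrite !divr_gt0// ltr_wpDl.
have e2 : 0 < e / 2 by rewrite divr_gt0.
have [f1 [Cf1 gf1]] := gd _ e1; have [f2 [Cf2 hf2]] := hd _ e2.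
exists (fun x => a * f1 x + f2 x); split; first exact: Cb_lin.
have -> : (fun x => a * g x + h x - (a * f1 x + f2 x)) =
          (fun x => a * (g x - f1 x) + (h x - f2 x)).
  by apply/funext => x; ring.
apply: (le_lt_trans (capacityD cP _ _)).
rewrite (splitr e) EFinD; apply: lteD => //.
apply: (le_lt_trans (capacityZ cP _ _)).
apply: (@le_lt_trans _ _ ((`|a| + 1)%:E * (e / 4 / (`|a| + 1))%:E)%E).
  apply: lee_pmul; rewrite ?lee_fin//; first exact: capacity_ge0.
    by rewrite lerDl.
  exact: ltW.
by rewrite -EFinM mulrC divfK ?gt_eqF ?ltr_wpDl// lte_fin; lra.
Qed.

Lemma L1B g h : L1 c g -> L1 c h -> L1 c (fun x => g x - h x).
Proof.
move=> Lg Lh; have := L1_lin (-1) Lh Lg.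
by under eq_fun do rewrite mulN1r addrC.
Qed.

Lemma L1D g h : L1 c g -> L1 c h -> L1 c (fun x => g x + h x).
Proof. by move=> Lg Lh; have := L1_lin 1 Lg Lh; under eq_fun do rewrite mul1r. Qed.

Lemma L1Z a g : L1 c g -> L1 c (fun x => a * g x).
Proof.
move=> Lg; have := L1_lin a Lg (L1_Cb (Cb_cst 0)).
by under eq_fun do rewrite addr0.
Qed.

Lemma csnD g h : L1 c g -> L1 c h -> csn (fun x => g x + h x) <= csn g + csn h.
Proof.
move=> Lg Lh; rewrite -lee_fin EFinD -!L1_csn//; last exact: L1D.
exact: capacityD.
Qed.

Lemma csnZ a g : L1 c g -> csn (fun x => a * g x) <= `|a| * csn g.
Proof.
move=> Lg; rewrite -lee_fin EFinM -!L1_csn//; last exact: L1Z.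
exact: capacityZ.
Qed.

Lemma csn_le g h : L1 c g -> L1 c h -> (forall x, `|g x| <= `|h x|) -> csn g <= csn h.
Proof. by move=> Lg Lh gh; rewrite -lee_fin -!L1_csn//; exact: capacity_le. Qed.

Lemma csn_dist_triangle k g h : L1 c g -> L1 c h -> L1 c k ->
  csn (fun x => g x - h x) <= csn (fun x => g x - k x) + csn (fun x => k x - h x).
Proof.
move=> Lg Lh Lk; have := csnD (L1B Lg Lk) (L1B Lk Lh).
by under eq_fun do rewrite addrA subrK.
Qed.

Lemma csn_dense g e : L1 c g -> 0 < e ->
  exists2 f, Cb f & csn (fun x => g x - f x) < e.
Proof.
move=> Lg e0; have [f [Cf gf]] := Lg.2 e e0; exists f => //.
by rewrite -lte_fin -L1_csn//; apply: L1B => //; exact: L1_Cb.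
Qed.

Lemma csn_decr0 u e : decr0 u -> 0 < e -> exists n, csn (u n) < e.
Proof.
move=> du e0; have [n ne] := capacity_decr0 cP du e0; exists n.
by rewrite -lte_fin -L1_csn//; apply: L1_Cb; case: du.
Qed.

(** Continuity with an explicit bound [K], on which the coding of forms and the weights of their sum
    rely. *)
Definition blin (K : R) Phi :=
  (forall a g h, L1 c g -> L1 c h -> Phi (fun x => a * g x + h x) = a * Phi g + Phi h) /\
  (forall g, L1 c g -> `|Phi g| <= K * csn g).

Section Linear.
Variable Phi : (T -> R) -> R.
Hypothesis lin : forall a g h, L1 c g -> L1 c h ->
  Phi (fun x => a * g x + h x) = a * Phi g + Phi h.

Lemma linL1_0 : Phi (fun=> 0) = 0.
Proof.
have L0 := L1_Cb (Cb_cst (T := T) 0 : Cb (fun _ : T => 0 : R)).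
by have := lin 1 L0 L0; under eq_fun do rewrite mul1r addr0; rewrite mul1r; lra.
Qed.

Lemma linL1B g h : L1 c g -> L1 c h -> Phi (fun x => g x - h x) = Phi g - Phi h.
Proof.
move=> Lg Lh; have := lin (-1) Lh Lg.
by under eq_fun do rewrite mulN1r addrC; rewrite mulN1r addrC.
Qed.

Lemma linL1Z a g : L1 c g -> Phi (fun x => a * g x) = a * Phi g.
Proof.
move=> Lg; have := lin a Lg (L1_Cb (Cb_cst 0)).
by under eq_fun do rewrite addr0; rewrite linL1_0 addr0.
Qed.

End Linear.

Lemma contlin_blin Phi : contlin c Phi -> exists2 K : R, 0 < K & blin K Phi.
Proof.
move=> [lin cont]; have L0 : L1 c (fun=> 0) by exact/L1_Cb/Cb_cst.
have [d d0 dP] := cont _ L0 1 ltr01.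
exists (2 / d); first by rewrite divr_gt0.
split => // g Lg; apply/ler_addgt0Pr => e e0.
(* [eta] keeps [t] meaningful when [csn g = 0]; its contribution [2 * eta / d] to the bound [1 / t]
   is exactly [e]. *)
pose eta := e * d / 2; have eta0 : 0 < eta by rewrite !(mulr_gt0, divr_gt0).
have N0 := csn_ge0 g.
pose t := d / (2 * (csn g + eta)).
have den0 : 0 < 2 * (csn g + eta) by rewrite mulr_gt0// ltr_wpDl.
have t0 : 0 < t by rewrite divr_gt0.
have := dP _ (L1Z t Lg); rewrite (linL1_0 lin) subr0 (linL1Z lin)//.
under eq_fun do rewrite subr0.
have -> : (c (fun x => (t * g x)%R) < d%:E)%E.
  apply: (le_lt_trans (capacityZ cP _ _)).
  rewrite L1_csn// -EFinM lte_fin gtr0_norm// /t mulrAC ltr_pdivrMr//.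
  by rewrite ltr_pM2l//; lra.
move=> /(_ isT); rewrite normrM gtr0_norm// -ltr_pdivlMl// mulr1 => /ltW.
move=> /le_trans; apply; rewrite invf_div ler_pdivrMr//.
have -> : (2 / d * csn g + e) * d = 2 * csn g + e * d by field; rewrite gt_eqF.
by rewrite /eta; lra.
Qed.

Lemma blin_contlin K Phi : blin K Phi -> contlin c Phi.
Proof.
move=> [lin bd]; split => // g Lg e e0.
exists (e / (`|K| + 1)); first by rewrite divr_gt0// ltr_wpDl.
move=> h Lh; rewrite L1_csn; last exact: L1B.
rewrite lte_fin ltr_pdivlMr ?ltr_wpDl// -(linL1B lin)// => he.
apply: (le_lt_trans (bd _ (L1B Lh Lg))); apply: le_lt_trans he.
rewrite mulrC ler_wpM2l ?csn_ge0//.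
by rewrite (le_trans (ler_norm _))// lerDl.
Qed.

Lemma blin_le K K' Phi : K <= K' -> blin K Phi -> blin K' Phi.
Proof.
move=> KK' [lin bd]; split => // g Lg; rewrite (le_trans (bd g Lg))//.
by rewrite ler_wpM2r// csn_ge0.
Qed.

Lemma nonnegL_Cb f : Cb f -> (forall x, 0 <= f x) -> nonnegL c f.
Proof.
move=> Cf f0; split; first exact: L1_Cb.
exists (fun=> f); split => // g Lg gf.
by rewrite gf; exact: cvg_cst.
Qed.

Lemma nonnegL_approx X : nonnegL c X -> forall e, 0 < e ->
  exists f, [/\ Cb f, forall x, 0 <= f x & csn (fun x => X x - f x) < e].
Proof.
move=> [LX [fn [Cfn /(_ X LX)]]] h e e0; move: h.
under [X in c X = _]eq_fun do rewrite subrr.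
move=> /(_ capacity0) /fine_cvgP [_] /cvgrPdist_lt /(_ e e0) [n _ /(_ n)].
move=> /(_ (leqnn n)) /=; rewrite sub0r normrN => h.
exists (fn n); split; [exact: (Cfn n).1|exact: (Cfn n).2|].
exact: le_lt_trans (ler_norm _) h.
Qed.

Lemma nonneg_form_Cb Phi : contlin c Phi ->
  (forall f, Cb f -> (forall x, 0 <= f x) -> 0 <= Phi f) -> nonneg_form c Phi.
Proof.
move=> /contlin_blin[K K0 [lin bd]] pos X pX.
have LX := pX.1; apply/ler_addgt0Pr => e e0.
have [f [Cf f0 Xf]] := nonnegL_approx pX (divr_gt0 e0 K0).
have Lf := L1_Cb Cf.
have := bd _ (L1B LX Lf); rewrite (linL1B lin)//.
move: Xf; rewrite ltr_pdivlMr// mulrC => Xf /le_lt_trans /(_ Xf).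
by rewrite ltr_norml => /andP[h _]; have := pos f Cf f0; lra.
Qed.

(** * Extension of bounded forms from C_b to L^1(c) *)

Section Extension.
Variables (K : R) (Phi0 : (T -> R) -> R).
Hypothesis K0 : 0 <= K.
Hypothesis lin0 : forall a f g, Cb f -> Cb g ->
  Phi0 (fun x => a * f x + g x) = a * Phi0 f + Phi0 g.
Hypothesis bd0 : forall f, Cb f -> `|Phi0 f| <= K * csn f.

(* The continuous extension of [Phi0]: the supremum equals [lim Phi0 f_n] for
   every sequence [f_n] of [C_b] converging to [g]. *)
Definition cext g : R := sup [set Phi0 f - K * csn (fun x => g x - f x) | f in [set f | Cb f]].

Lemma Phi0_dist f f' : Cb f -> Cb f' ->
  `|Phi0 f - Phi0 f'| <= K * csn (fun x => f x - f' x).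
Proof.
move=> Cf Cf'; have := lin0 (-1) Cf' Cf.
under eq_fun do rewrite mulN1r addrC; rewrite mulN1r addrC => <-.
by apply: bd0; exact: CbB.
Qed.

(** By the triangle inequality through [g], every [f'] in C_b gives the upper bound
    [Phi0 f' + K * csn (g - f')] of the set whose supremum is [cext g]; the member of that set at
    [f] gives the lower bound. *)
Lemma cext_dist g f : L1 c g -> Cb f ->
  `|cext g - Phi0 f| <= K * csn (fun x => g x - f x).
Proof.
move=> Lg Cf; have Lf := L1_Cb Cf.
set S := [set Phi0 f - K * csn (fun x => g x - f x) | f in [set f | Cb f]].
have ub f' : Cb f' -> ubound S (Phi0 f' + K * csn (fun x => g x - f' x)).
  move=> Cf' _ [h Ch <-]; have Lf' := L1_Cb Cf'; have Lh := L1_Cb Ch.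
  have := Phi0_dist Ch Cf'; rewrite ler_norml => /andP[_ h1].
  have := csn_dist_triangle Lh Lf' Lg; rewrite (csn_distC h g) => h2.
  by have := ler_wpM2l K0 h2; rewrite mulrDr; lra.
rewrite ler_norml; apply/andP; split.
  have : Phi0 f - K * csn (fun x => g x - f x) <= cext g.
    apply: ub_le_sup; last by exists f.
    by exists (Phi0 f + K * csn (fun x => g x - f x)); exact: ub.
  by lra.
have : cext g <= Phi0 f + K * csn (fun x => g x - f x).
  by apply: ge_sup; [by eexists; exists f|exact: ub].
by lra.
Qed.

Lemma cext_Cb f : Cb f -> cext f = Phi0 f.
Proof.
move=> Cf; apply/eqP; rewrite -subr_eq0 -normr_le0.
have := cext_dist (L1_Cb Cf) Cf; under [X in csn X]eq_fun do rewrite subrr.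
by rewrite /csn capacity0 mulr0.
Qed.

Lemma cext_blin : blin K cext.
Proof.
split; last first.
  move=> g Lg; have C0 : Cb (fun _ : T => 0 : R) by exact: Cb_cst.
  have := cext_dist Lg C0; under [X in csn X]eq_fun do rewrite subr0.
  suff -> : Phi0 (fun=> 0) = 0 by rewrite subr0.
  by have := lin0 1 C0 C0; under eq_fun do rewrite mul1r addr0; rewrite mul1r; lra.
move=> a g h Lg Lh; apply/eqP; rewrite -subr_eq0 -normr_le0.
apply/ler_addgt0Pr => e e0; rewrite add0r.
(* The total error is at most [2 * K * (|a| + 1) * eta]: half from the combination, half from its
   two terms. *)
pose eta := e / (2 * (K + 1) * (`|a| + 1)).
have den : 0 < 2 * (K + 1) * (`|a| + 1) by rewrite !mulr_gt0// ltr_wpDl.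
have eta0 : 0 < eta by rewrite divr_gt0.
have [f1 Cf1 gf1] := csn_dense Lg eta0.
have [f2 Cf2 hf2] := csn_dense Lh eta0.
have Lf1 := L1_Cb Cf1; have Lf2 := L1_Cb Cf2.
have e1 := cext_dist Lg Cf1; have e2 := cext_dist Lh Cf2.
have e3 := cext_dist (L1_lin a Lg Lh) (Cb_lin a Cf1 Cf2).
have e4 : csn (fun x => a * g x + h x - (a * f1 x + f2 x)) <=
    `|a| * csn (fun x => g x - f1 x) + csn (fun x => h x - f2 x).
  have -> : (fun x => a * g x + h x - (a * f1 x + f2 x)) =
          (fun x => a * (g x - f1 x) + (h x - f2 x)).
    by apply/funext => x; ring.
  apply: (le_trans (csnD (L1Z _ (L1B Lg Lf1)) (L1B Lh Lf2))).
  by rewrite lerD2r; apply: csnZ; exact: L1B.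
rewrite (lin0 a Cf1 Cf2) in e3.
set A := cext (fun x => a * g x + h x) in e3 *.
have -> : A - (a * cext g + cext h) = (A - (a * Phi0 f1 + Phi0 f2))
   - a * (cext g - Phi0 f1) - (cext h - Phi0 f2) by ring.
apply: (le_trans (ler_normB _ _)); apply: (le_trans (lerD (ler_normB _ _) (lexx _))).
rewrite normrM.
have u1 := ler_wpM2l K0 e4; have u2 := ler_wpM2l (normr_ge0 a) e1.
set n1 := csn (fun x => g x - f1 x) in e1 gf1 u1 u2 *.
set n2 := csn (fun x => h x - f2 x) in e2 hf2 u1 *.
have a0 : 0 <= `|a| by [].
have v1 : K * (`|a| * n1) <= K * (`|a| * eta) by rewrite ler_wpM2l// ler_wpM2l// ltW.
have v2 : K * n2 <= K * eta by rewrite ler_wpM2l// ltW.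
have : eta * (2 * (K + 1) * (`|a| + 1)) = e by rewrite divfK// gt_eqF.
have w1 : 0 <= `|a| * eta by rewrite mulr_ge0// ltW.
lra.
Qed.

End Extension.
End CapacityL1.

(** * Decomposition of a form into non-negative ones *)

Section Decomposition.
Context {R : realType} {T : ptopologicalType} (c : (T -> R) -> \bar R).
Hypothesis cP : capacity c.
Implicit Types (f g h X : T -> R) (Phi : (T -> R) -> R).

Section ConeExtension.
Variables (K : R) (psi : (T -> R) -> R).
Hypothesis K0 : 0 <= K.
Hypothesis psiD : forall f g, Cb f -> Cb g -> (forall x, 0 <= f x) ->
  (forall x, 0 <= g x) -> psi (fun x => f x + g x) = psi f + psi g.
Hypothesis psiZ : forall a f, 0 <= a -> Cb f -> (forall x, 0 <= f x) ->
  psi (fun x => a * f x) = a * psi f.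
Hypothesis psi_bd : forall f, Cb f -> (forall x, 0 <= f x) -> 0 <= psi f <= K * csn c f.

Let pos f x := Num.max (f x) 0.
Let neg f x := Num.max (- f x) 0.

Let pos0 f x : 0 <= pos f x. Proof. by rewrite le_max lexx orbT. Qed.
Let neg0 f x : 0 <= neg f x. Proof. by rewrite le_max lexx orbT. Qed.
Let Cpos f : Cb f -> Cb (pos f).
Proof. by move=> Cf; apply: Cb_max => //; exact: Cb_cst. Qed.
Let Cneg f : Cb f -> Cb (neg f).
Proof.
move=> Cf; apply: Cb_max; last exact: Cb_cst.
by have := CbZ (-1) Cf; under eq_fun do rewrite mulN1r.
Qed.
Let posneg f x : f x = pos f x - neg f x.
Proof. by rewrite /pos /neg; case: (leP (f x) 0); case: (leP (- f x) 0) => ? ?; lra. Qed.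
Let absposneg f x : `|f x| = pos f x + neg f x.
Proof.
rewrite /pos /neg; have [h|h] := leP 0 (f x).
  by rewrite ger0_norm//; case: (leP (- f x) 0) => ?; lra.
by rewrite ltr0_norm//; case: (leP (- f x) 0) => ?; lra.
Qed.

Let Psi f := psi (pos f) - psi (neg f).

Let PsiE f u v : Cb u -> Cb v -> Cb f -> (forall x, 0 <= u x) -> (forall x, 0 <= v x) ->
  (forall x, f x = u x - v x) -> Psi f = psi u - psi v.
Proof.
move=> Cu Cv Cf u0 v0 fuv.
have := psiD (Cpos Cf) Cv (pos0 f) v0.
have -> : (fun x => pos f x + v x) = (fun x => neg f x + u x).
  by apply/funext => x; have := fuv x; rewrite (posneg f); lra.
by rewrite (psiD (Cneg Cf) Cu (neg0 f) u0) /Psi; lra.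
Qed.

(** The extension is [psi (f^+) - psi (f^-)]. By additivity it equals [psi u - psi v] for every
    decomposition [f = u - v] into non-negative functions of C_b, which gives linearity; the bound
    comes from [f^+ + f^- = |f|]. *)
Lemma cone_linear_extension : exists Phi,
  [/\ forall a f g, Cb f -> Cb g -> Phi (fun x => a * f x + g x) = a * Phi f + Phi g,
      forall f, Cb f -> `|Phi f| <= K * csn c f &
      forall f, Cb f -> (forall x, 0 <= f x) -> Phi f = psi f].
Proof.
exists Psi; split; last 2 first.
- move=> f Cf; apply: (@le_trans _ _ (psi (pos f) + psi (neg f))).
    have /andP[h1 _] := psi_bd (Cpos Cf) (pos0 f).
    have /andP[h2 _] := psi_bd (Cneg Cf) (neg0 f).
    by rewrite /Psi ler_norml; lra.
  rewrite -(psiD (Cpos Cf) (Cneg Cf) (pos0 f) (neg0 f)).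
  have -> : (fun x => pos f x + neg f x) = (fun x => `|f x|).
    by apply/funext => x; rewrite absposneg.
  have Caf := Cb_abs Cf.
  have /andP[_ /le_trans] := psi_bd Caf (fun x => normr_ge0 _); apply.
  rewrite ler_wpM2l//; apply: csn_le => //; [exact: L1_Cb|exact: L1_Cb|].
  by move=> x; rewrite normr_id.
- move=> f Cf f0; have C0 := Cb_cst (T := T) (0 : R).
  rewrite (PsiE Cf C0 Cf f0)//; last by move=> x; rewrite subr0.
  have := psiZ (lexx 0) C0 (fun=> lexx 0).
  by under eq_fun do rewrite mul0r; rewrite mul0r => ->; rewrite subr0.
move=> a f g Cf Cg; have Cl := Cb_lin a Cf Cg.
have ge0 b u v x : 0 <= b -> 0 <= u x -> 0 <= v x -> 0 <= b * u x + v x :> R.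
  by move=> b0 u0 v0; rewrite addr_ge0// mulr_ge0.
have psil b u v : 0 <= b -> Cb u -> Cb v -> (forall x, 0 <= u x) ->
    (forall x, 0 <= v x) -> psi (fun x => b * u x + v x) = b * psi u + psi v.
  move=> b0 Cu Cv u0 v0; rewrite psiD ?psiZ//; first exact: CbZ.
  by move=> x; rewrite mulr_ge0.
have [a0|/ltW a0] := leP 0 a.
  rewrite (@PsiE _ (fun x => a * pos f x + pos g x) (fun x => a * neg f x + neg g x)).
  - by rewrite !psil//; try exact: Cpos; try exact: Cneg; rewrite /Psi; ring.
  - by apply: Cb_lin; exact: Cpos.
  - by apply: Cb_lin; exact: Cneg.
  - exact: Cl.
  - by move=> x; exact: ge0.
  - by move=> x; exact: ge0.
  - by move=> x; rewrite (posneg f) (posneg g); ring.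
have a0' : 0 <= - a by rewrite oppr_ge0.
rewrite (@PsiE _ (fun x => (- a) * neg f x + pos g x) (fun x => (- a) * pos f x + neg g x)).
- by rewrite !psil//; try exact: Cpos; try exact: Cneg; rewrite /Psi; ring.
- by apply: Cb_lin; [exact: Cneg|exact: Cpos].
- by apply: Cb_lin; [exact: Cpos|exact: Cneg].
- exact: Cl.
- by move=> x; exact: ge0.
- by move=> x; exact: ge0.
- by move=> x; rewrite (posneg f) (posneg g); ring.
Qed.

End ConeExtension.

Lemma blin_Cb_extension K (Phi0 : (T -> R) -> R) : 0 <= K ->
  (forall a f g, Cb f -> Cb g -> Phi0 (fun x => a * f x + g x) = a * Phi0 f + Phi0 g) ->
  (forall f, Cb f -> `|Phi0 f| <= K * csn c f) ->
  exists2 Phi, blin c K Phi & forall f, Cb f -> Phi f = Phi0 f.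
Proof.
move=> K0 lin0 bd0; exists (cext c K Phi0); first exact: cext_blin.
by move=> f Cf; exact: (cext_Cb cP K0 lin0 bd0).
Qed.

Section PositivePart.
Variables (K : R) (Phi : (T -> R) -> R).
Hypotheses (K0 : 0 <= K) (bPhi : blin c K Phi).

Let S f := [set Phi g | g in [set g | Cb g /\ forall x, 0 <= g x <= f x]].
(** Riesz's formula for the positive part of [Phi] on the cone of non-negative functions. *)
Let psi f : R := sup (S f).

Let PhiD f g : Cb f -> Cb g -> Phi (fun x => f x + g x) = Phi f + Phi g.
Proof.
move=> Cf Cg; have := bPhi.1 1 _ _ (L1_Cb cP Cf) (L1_Cb cP Cg).
by under eq_fun do rewrite mul1r; rewrite mul1r.
Qed.

Let ubS f : Cb f -> (forall x, 0 <= f x) -> ubound (S f) (K * csn c f).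
Proof.
move=> Cf f0 _ [g [Cg gf] <-].
rewrite (le_trans (ler_norm _))// (le_trans (bPhi.2 _ (L1_Cb cP Cg)))//.
rewrite ler_wpM2l//; apply: csn_le => //; [exact: L1_Cb|exact: L1_Cb|].
by move=> x; have /andP[g0 gx] := gf x; rewrite !ger0_norm.
Qed.

Let S0 f : (forall x, 0 <= f x) -> S f 0.
Proof.
move=> f0; exists (fun=> 0); last exact: (linL1_0 cP bPhi.1).
by split; [exact: Cb_cst|move=> x; rewrite lexx f0].
Qed.

Let psi_ub f g : Cb f -> Cb g -> (forall x, 0 <= g x <= f x) -> Phi g <= psi f.
Proof.
move=> Cf Cg gf; apply: ub_le_sup; last by exists g.
exists (K * csn c f); apply: ubS => // x.
by have /andP[g0 gx] := gf x; exact: le_trans gx.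
Qed.

Let psi_le f M : (forall x, 0 <= f x) ->
  (forall g, Cb g -> (forall x, 0 <= g x <= f x) -> Phi g <= M) -> psi f <= M.
Proof.
move=> f0 h; apply: ge_sup; first by exists 0; exact: S0.
by move=> _ [g [Cg gf] <-]; exact: h.
Qed.

Let psi_bd f : Cb f -> (forall x, 0 <= f x) -> 0 <= psi f <= K * csn c f.
Proof.
move=> Cf f0; apply/andP; split.
  by rewrite -(linL1_0 cP bPhi.1); apply: psi_ub => //; [exact: Cb_cst|move=> x; rewrite lexx f0].
by apply: ge_sup; [exists 0; exact: S0|exact: ubS].
Qed.

Let psiD f g : Cb f -> Cb g -> (forall x, 0 <= f x) ->
  (forall x, 0 <= g x) -> psi (fun x => f x + g x) = psi f + psi g.
Proof.
move=> Cf Cg f0 g0; have Cfg := CbD Cf Cg; apply/eqP; rewrite eq_le; apply/andP; split.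
  apply: psi_le => [x|h Ch hfg]; first by rewrite addr_ge0.
  (* Riesz splitting of [0 <= h <= f + g]: [min h f] lies below [f] and the rest [h - min h f] below
     [g]. *)
  pose h1 x := Num.min (h x) (f x).
  have Ch1 : Cb h1 by exact: Cb_min.
  have -> : h = (fun x => h1 x + (h x - h1 x)) by apply/funext => x; rewrite addrC subrK.
  rewrite (PhiD Ch1 (CbB Ch Ch1)); apply: lerD; apply: psi_ub => //.
  - move=> x; have /andP[hx0 hx] := hfg x.
    by rewrite le_min hx0 f0 ge_min lexx orbT.
  - exact: CbB.
  - move=> x; have /andP[hx0 hx] := hfg x.
    by rewrite /h1; case: (leP (h x) (f x)) => ?; rewrite ?subrr ?lexx ?g0//; lra.
rewrite -lerBrDr; apply: psi_le => // u Cu uf.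
rewrite lerBrDr addrC -lerBrDr; apply: psi_le => // v Cv vg.
rewrite lerBrDr -PhiD//; apply: psi_ub => //; first exact: CbD.
move=> x; have := uf x; have := vg x => /andP[? ?] /andP[? ?].
by apply/andP; split; lra.
Qed.

Let psiZ a f : 0 <= a -> Cb f -> (forall x, 0 <= f x) ->
  psi (fun x => a * f x) = a * psi f.
Proof.
rewrite le_eqVlt => /predU1P[<- Cf f0|].
  rewrite mul0r; under eq_fun do rewrite mul0r.
  have /andP[h1 h2] := psi_bd (Cb_cst 0) (fun _ : T => lexx (0 : R)).
  apply/eqP; rewrite eq_le h1 andbT (le_trans h2)//.
  by rewrite /csn (capacity0 cP) mulr0.
move: a f.
(* One inequality for all [a > 0] is enough: applied to [a^-1] and [a * f] it gives the converse. *)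
have half a f : 0 < a -> Cb f -> (forall x, 0 <= f x) ->
    psi (fun x => a * f x) <= a * psi f.
  move=> a0 Cf f0; apply: psi_le => [x|g Cg gf]; first by rewrite mulr_ge0// ltW.
  rewrite -ler_pdivrMl// -(linL1Z cP bPhi.1); last exact: L1_Cb.
  apply: psi_ub => //; first exact: CbZ.
  move=> x; have /andP[g0 gx] := gf x; rewrite ler_pdivrMl// gx andbT.
  by rewrite mulr_ge0// invr_ge0 ltW.
move=> a f a0 Cf f0; apply/eqP; rewrite eq_le half// andTb.
rewrite -ler_pdivlMl//; have aV0 : 0 < a^-1 by rewrite invr_gt0.
have := half a^-1 (fun x => a * f x) aV0 (CbZ a Cf).
under [X in psi X]eq_fun do rewrite mulKf ?gt_eqF//.
by apply => x; rewrite mulr_ge0// ltW.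
Qed.

Lemma positive_part : exists Psi, [/\ blin c K Psi,
  forall f, Cb f -> (forall x, 0 <= f x) -> 0 <= Psi f &
  forall f, Cb f -> (forall x, 0 <= f x) -> Phi f <= Psi f].
Proof.
have [Psi0 [lin bd PsiE]] := cone_linear_extension K0 psiD psiZ psi_bd.
have [Psi bPsi Psi0E] := blin_Cb_extension K0 lin bd.
exists Psi; split => // f Cf f0; rewrite Psi0E// PsiE//.
  by have /andP[] := psi_bd Cf f0.
by apply: psi_ub => // x; rewrite f0 lexx.
Qed.

End PositivePart.

Lemma contlin_lin a Phi Psi : contlin c Phi -> contlin c Psi ->
  contlin c (fun g => a * Phi g + Psi g).
Proof.
move=> /(contlin_blin cP)[K K0 [lin bd]] /(contlin_blin cP)[K' K'0 [lin' bd']].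
apply: (@blin_contlin _ _ _ cP (`|a| * K + K')); split.
  by move=> b g h Lg Lh; rewrite lin// lin'//; ring.
move=> g Lg; rewrite (le_trans (ler_normD _ _))// mulrDl lerD ?bd'//.
by rewrite normrM -mulrA ler_wpM2l// bd.
Qed.

Lemma contlin_decomposition Phi : contlin c Phi -> exists Psi1 Psi2,
  [/\ contlin c Psi1 /\ nonneg_form c Psi1, contlin c Psi2 /\ nonneg_form c Psi2 &
      forall g, Phi g = Psi1 g - Psi2 g].
Proof.
move=> cPhi; have [K K0 bPhi] := contlin_blin cP cPhi.
have [Psi [bPsi Psi0 PhiPsi]] := positive_part (ltW K0) bPhi.
have cPsi := blin_contlin cP bPsi.
have cPsi2 := contlin_lin (-1) cPhi cPsi.
exists Psi, (fun g => -1 * Phi g + Psi g); split.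
- by split => //; exact: nonneg_form_Cb.
- split => //; apply: nonneg_form_Cb => // f Cf f0.
  by rewrite mulN1r addrC subr_ge0 PhiPsi.
- by move=> g; ring.
Qed.

End Decomposition.

(** * Countable dense families of non-negative forms *)

Section Families.
Context {R : realType} {T : ptopologicalType} (c : (T -> R) -> \bar R).
Hypothesis cP : capacity c.
Implicit Types (f g h X : T -> R) (Phi Psi : (T -> R) -> R).

Section CountableFamily.
Variable D : nat -> T -> R.
Hypothesis DCb : forall n, Cb (D n).
Hypothesis Ddense : forall f e, Cb f -> 0 < e ->
  exists n, csn c (fun x => f x - D n x) < e.

Lemma L1_dense_sequence g e : L1 c g -> 0 < e ->
  exists n, csn c (fun x => g x - D n x) < e.
Proof.
move=> Lg e0; have e20 : 0 < e / 2 by rewrite divr_gt0.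
have [f Cf gf] := csn_dense cP Lg e20; have [n fn] := Ddense Cf e20.
exists n; have LD : L1 c (D n) by exact: L1_Cb.
have := csn_dist_triangle cP Lg LD (L1_Cb cP Cf); lra.
Qed.

(* The norm bound [K] belongs to the code so that two forms with the same code,
   being close on part of the dense sequence, are close on all of L^1. *)
Definition coded (s : nat * nat * seq int) Phi :=
  let: (K, n, q) := s in
  [/\ blin c K%:R Phi, nonneg_form c Phi & forall j, (j < n)%N ->
      `|Phi (D j) - (nth 0%R q j)%:~R / n.+1%:R| <= n.+1%:R^-1].

(** At [D j] both forms lie within [1 / (n + 1)] of the same rational, and the common bound [K]
    limits the cost of passing from [D j] to [X] to [K * e] for each of them. *)
Lemma coded_cvg K n q Phi Psi X e : coded (K, n, q) Phi -> coded (K, n, q) Psi ->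
  L1 c X -> 0 < e -> forall j, (j < n)%N -> csn c (fun x => X x - D j x) <= e ->
  `|Phi X - Psi X| <= 2 * K%:R * e + 2 * n.+1%:R^-1.
Proof.
move=> [[lin bd] _ PhiD] [[lin' bd'] _ PsiD] LX e0 j jn Xj.
have Lj := L1_Cb cP (DCb j).
have h1 := bd _ (L1B cP LX Lj); have h2 := bd' _ (L1B cP LX Lj).
rewrite (linL1B lin)// in h1; rewrite (linL1B lin')// in h2.
have h3 := PhiD j jn; have h4 := PsiD j jn.
have h5 : K%:R * csn c (fun x => X x - D j x) <= K%:R * e by rewrite ler_wpM2l.
move: h3 h4; set v := n.+1%:R^-1; set w := _ * v => h3 h4.
move: h1 h2 h3 h4; rewrite !ler_norml.
move=> /andP[? ?] /andP[? ?] /andP[? ?] /andP[? ?]; apply/andP; split; lra.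
Qed.

(** One form is chosen for each code that some form possesses. A given [Phi] possesses the codes
    [s n] of growing precision, so the forms chosen for these codes converge to [Phi] by
    [coded_cvg]. *)
Lemma countable_family : exists L : nat -> (T -> R) -> R,
  (forall n, contlin c (L n) /\ nonneg_form c (L n)) /\
  forall Phi, contlin c Phi -> nonneg_form c Phi -> exists a : nat -> nat,
    forall X, L1 c X -> (fun n => L (a n) X) @ \oo --> Phi X.
Proof.
have blin0 : blin c 0 (fun _ : T -> R => 0).
  by split=> *; rewrite ?mulr0 ?addr0 ?normr0 ?mul0r.
have Ls s : exists Phi, (contlin c Phi /\ nonneg_form c Phi) /\
    ((exists Psi, coded s Psi) -> coded s Phi).
  have [[Psi cPsi]|nex] := pselect (exists Psi, coded s Psi).
    exists Psi; split => //; move: s cPsi => [[K n] q] [bPsi pPsi _].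
    by split => //; exact: (blin_contlin cP bPsi).
  exists (fun=> 0); split; last by [].
  by split; [exact: (blin_contlin cP blin0)|move=> X _].
have [L LP] := choice Ls.
exists (fun n => if unpickle n is Some s then L s else fun=> 0); split.
  move=> n; case: unpickle => [s|]; first exact: (LP s).1.
  by split; [exact: (blin_contlin cP blin0)|move=> X _].
move=> Phi cPhi pPhi; have [K0 K00 bPhi] := contlin_blin cP cPhi.
pose K := (Num.truncn K0).+1.
(* Rounding down to a multiple of [1 / (n + 1)] errs by less than [1 / (n + 1)]. *)
pose s n := (K, n, [seq Num.floor (Phi (D j) * n.+1%:R) | j <- iota 0 n]).
have sPhi n : coded (s n) Phi.
  split => //; first exact: (blin_le _ (ltW (truncnS_gt K0)) bPhi).
  move=> j jn; rewrite (nth_map 0%N) ?size_iota// nth_iota// add0n.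
  have n0 : 0 < n.+1%:R :> R by [].
  rewrite -(ler_pM2r n0) mulVf ?gt_eqF// -[X in _ * X <= _](gtr0_norm n0) -normrM mulrBl.
  rewrite divfK ?gt_eqF//; set t := Phi _ * _.
  have h1 := floor_le t; have := floorD1_gt t; rewrite intrD => h2.
  by rewrite ger0_norm; lra.
exists (fun n => pickle (s n)) => X LX.
under eq_fun do rewrite pickleK.
have sL n : coded (s n) (L (s n)) by apply: (LP (s n)).2; exists Phi.
apply/cvgrPdist_lt => e e0.
have K1 : 0 < K%:R :> R by [].
(* In [coded_cvg] the first term becomes [2 * K * e1 = e / 2] and the second is below [e / 2] from
   [m] on; [n > j] brings [D j] within reach of the code. *)
pose e1 := e / (4 * K%:R).
have e10 : 0 < e1 by rewrite divr_gt0// mulr_gt0.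
have [j Xj] := L1_dense_sequence LX e10.
pose m := Num.truncn (4 / e).
have me : m.+1%:R^-1 < e / 4.
  by rewrite -invf_div ltf_pV2 ?posrE ?divr_gt0// truncnS_gt.
exists (maxn j.+1 m) => // n /=; rewrite geq_max => /andP[jn mn].
apply: (le_lt_trans (coded_cvg (sPhi n) (sL n) LX e10 jn (ltW Xj))).
have : n.+1%:R^-1 <= m.+1%:R^-1 :> R by rewrite lef_pV2 ?posrE// ler_nat.
have -> : 2 * K%:R * e1 = e / 2 by rewrite /e1; field; rewrite gt_eqF.
move: me; set u := m.+1%:R^-1; set v := n.+1%:R^-1; lra.
Qed.

End CountableFamily.

(** [Psi] is the sum of the [b n * L n] with [b n = 2^-(n+1) / K n], where [K n] bounds [L n]; the
    series converges absolutely on [L1], with bound 1. When its terms are non-negative, each of them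
    is at most the sum. *)
Lemma dominating_form (L : nat -> (T -> R) -> R) :
  (forall n, contlin c (L n) /\ nonneg_form c (L n)) ->
  exists Psi (b : nat -> R), [/\ contlin c Psi, forall n, 0 < b n &
    forall n X, (forall k, 0 <= L k X) -> L1 c X -> b n * L n X <= Psi X].
Proof.
move=> LP.
have Kex n : exists K, 0 < K /\ blin c K (L n).
  by have [K K0 bK] := contlin_blin cP (LP n).1; exists K.
have [K KP] := choice Kex.
pose b n := (K n)^-1 / (2 ^ (n + 1))%:R.
have two0 n : 0 < (2 ^ (n + 1))%:R :> R by rewrite ltr0n expn_gt0.
have b0 n : 0 < b n by rewrite divr_gt0// invr_gt0; case: (KP n).
pose u X n := b n * L n X.
have uN X n : L1 c X -> `|u X n| <= csn c X / (2 ^ (n + 1))%:R.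
  move=> LX; rewrite normrM gtr0_norm// /b mulrAC ler_pM2r ?invr_gt0//.
  have [Kn0 [_ bd]] := KP n.
  by rewrite ler_pdivrMl//; exact: bd.
have cg X := @cvg_geometric_series_half R (csn c X) 0.
have nc X : L1 c X -> cvgn [normed series (u X)].
  move=> LX; apply: (series_le_cvg _ _ (uN X ^~ LX)).
  - by move=> n; exact: normr_ge0.
  - by move=> n; rewrite divr_ge0// ?csn_ge0// ltW.
  - by apply/cvg_ex; eexists; exact: cg.
have sc X : L1 c X -> cvgn (series (u X)) by move=> /nc /normed_cvg.
pose Psi X := limn (series (u X)).
have bPsi : blin c 1 Psi.
  split; last first.
    move=> X LX; rewrite mul1r (le_trans (lim_series_norm (nc X LX)))//.
    have lim2 := cvg_lim (@Rhausdorff R) (cg X).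
    rewrite expr0 divr1 in lim2; rewrite -[leRHS]lim2.
    apply: lim_series_le => [||n]; [exact: nc|by apply/cvg_ex; eexists; exact: cg|].
    exact: uN.
  move=> a X Y LX LY; rewrite /Psi.
  have -> : series (u (fun x => a * X x + Y x)) = (fun n => a * series (u X) n + series (u Y) n).
    apply/funext => n; rewrite /series /= mulr_sumr -big_split/=.
    by apply: eq_bigr => k _; rewrite /u ((LP k).1.1 a X Y LX LY); ring.
  apply: cvg_lim => //; apply: cvgD; last exact: sc.
  by apply: cvgM; [exact: cvg_cst|exact: sc].
exists Psi, b; split => //; first exact: (blin_contlin cP bPsi).
move=> n X L0 LX.
have u0 k : 0 <= u X k by rewrite mulr_ge0// ltW.
apply: (@le_trans _ _ (series (u X) n.+1)).
  by rewrite /series/= big_nat_recr//= lerDr sumr_ge0.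
apply: nondecreasing_cvgn_le; last exact: sc.
by apply/nondecreasing_series => k _ _.
Qed.

End Families.

(** * Representation of forms by measures *)

Section Riesz.
Context {R : realType} {T : ptopologicalType} (d : T -> T -> R).
Hypothesis dP : metrizes d.
Implicit Types (f g h : T -> R) (A G U V X : set T).

Definition daniell (Phi : (T -> R) -> R) : Prop :=
  [/\ forall a f g, Cb f -> Cb g -> Phi (fun x => a * f x + g x) = a * Phi f + Phi g,
      forall f, Cb f -> (forall x, 0 <= f x) -> 0 <= Phi f &
      forall u e, decr0 u -> 0 < e -> exists n, Phi (u n) < e].

Definition under G f := Cb f /\ forall x, 0 <= f x <= \1_G x.

Definition inner_content (Phi : (T -> R) -> R) G : \bar R :=
  ereal_sup [set (Phi f)%:E | f in under G].

Definition outer_content (Phi : (T -> R) -> R) A : \bar R :=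
  ereal_inf [set inner_content Phi G | G in [set G | open G /\ A `<=` G]].

Lemma under_in G f x : under G f -> f x <= 1.
Proof.
by move=> [_ /(_ x)/andP[_ h]]; rewrite (le_trans h)// indicE; case: (_ \in _).
Qed.

Lemma under_out G f x : under G f -> ~ G x -> f x = 0.
Proof.
move=> [_ /(_ x)] + nGx; rewrite indicE memNset//= => h.
by apply/eqP; rewrite eq_le andbC.
Qed.

Lemma underP G f : Cb f -> (forall x, 0 <= f x) -> (forall x, f x <= 1) ->
  (forall x, ~ G x -> f x = 0) -> under G f.
Proof.
move=> Cf f0 f1 fG; split => // x; rewrite f0 indicE.
have [_|/negP xG] := boolP (x \in G); first by rewrite f1.
by rewrite fG ?lexx// => /mem_set.
Qed.

Lemma open_indic_lsc G : open G -> lower_semicontinuous (EFin \o (\1_G : T -> R)).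
Proof.
move=> oG; apply/lscP => x a; rewrite indicE.
have [/set_mem Gx a1|_ a0] := boolP (x \in G).
  apply: filterS (open_nbhs_nbhs (conj oG Gx)) => y Gy.
  by rewrite indicE mem_set.
by apply: nearW => y; rewrite indicE (lt_le_trans a0)//; case: (_ \in _).
Qed.

Lemma indic_ge0 G x : 0 <= \1_G x :> R.
Proof. by rewrite indicE; case: (_ \in _). Qed.

Lemma open_measurable_borel G : open G -> measurable (G : set (@borelT T)).
Proof. by move=> oG; exact: sub_sigma_algebra. Qed.

Section OneForm.
Variable Phi : (T -> R) -> R.
Hypothesis dPhi : daniell Phi.

Let lin : forall a f g, Cb f -> Cb g -> Phi (fun x => a * f x + g x) = a * Phi f + Phi g.
Proof. by case: dPhi. Qed.
Let pos : forall f, Cb f -> (forall x, 0 <= f x) -> 0 <= Phi f.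
Proof. by case: dPhi. Qed.

Let PhiD f g : Cb f -> Cb g -> Phi (fun x => f x + g x) = Phi f + Phi g.
Proof.
by move=> Cf Cg; have := lin 1 Cf Cg; under eq_fun do rewrite mul1r; rewrite mul1r.
Qed.

Let Phi0 : Phi (fun=> 0) = 0.
Proof.
by have := PhiD (Cb_cst 0) (Cb_cst 0); under eq_fun do rewrite addr0; lra.
Qed.

Let PhiZ a f : Cb f -> Phi (fun x => a * f x) = a * Phi f.
Proof.
by move=> Cf; have := lin a Cf (Cb_cst 0); under eq_fun do rewrite addr0; rewrite Phi0 addr0.
Qed.

Let PhiB f g : Cb f -> Cb g -> Phi (fun x => f x - g x) = Phi f - Phi g.
Proof.
move=> Cf Cg; have := lin (-1) Cg Cf.
by under eq_fun do rewrite mulN1r addrC; rewrite mulN1r addrC.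
Qed.

Let Phi_le f g : Cb f -> Cb g -> (forall x, f x <= g x) -> Phi f <= Phi g.
Proof.
move=> Cf Cg fg; rewrite -subr_ge0 -PhiB//; apply: pos; first exact: CbB.
by move=> x; rewrite subr_ge0.
Qed.

Let Phi_sum (n : nat) (F : nat -> T -> R) : (forall k, Cb (F k)) ->
  Cb (fun x => \sum_(k < n) F k x) /\
  Phi (fun x => \sum_(k < n) F k x) = \sum_(k < n) Phi (F k).
Proof.
move=> CF; elim: n => [|n [IH1 IH2]].
  by rewrite big_ord0; under eq_fun do rewrite big_ord0; split; [exact: Cb_cst|].
rewrite big_ord_recr/= -IH2 -PhiD//; under eq_fun do rewrite big_ord_recr/=.
by split => //; exact: CbD.
Qed.

Local Notation v := (inner_content Phi).
Local Notation m := (outer_content Phi).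

Let v_ge G f : under G f -> ((Phi f)%:E <= v G)%E.
Proof. by move=> Gf; apply: ereal_sup_ubound; exists f. Qed.

Let v_ge0 G : (0 <= v G)%E.
Proof.
rewrite -[leLHS]/(0%:E) -[in leLHS]Phi0; apply: v_ge; split; first exact: Cb_cst.
by move=> x; rewrite lexx indic_ge0.
Qed.

Let v_le1 G : (v G <= (Phi (fun=> 1))%:E)%E.
Proof.
apply: ge_ereal_sup => _ [f Gf <-]; rewrite lee_fin; apply: Phi_le.
- by case: Gf.
- exact: Cb_cst.
- by move=> x; exact: under_in Gf.
Qed.

Let v_le U V : U `<=` V -> (v U <= v V)%E.
Proof.
move=> UV; apply: ge_ereal_sup => _ [f Uf <-]; apply: v_ge; apply: underP.
- by case: Uf.
- by move=> x; case: Uf => _ /(_ x)/andP[].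
- by move=> x; exact: under_in Uf.
- by move=> x nVx; apply: (under_out Uf) => /UV.
Qed.

Let m_ge0 A : (0 <= m A)%E.
Proof. by apply: le_ereal_inf_tmp => _ [G _ <-]. Qed.

Let m_leP A G : open G -> A `<=` G -> (m A <= v G)%E.
Proof. by move=> oG AG; apply: ereal_inf_lbound; exists G. Qed.

Let m_le A B : A `<=` B -> (m A <= m B)%E.
Proof.
move=> AB; apply: le_ereal_inf_tmp => _ [G [oG BG] <-].
by apply: m_leP => // x /AB /BG.
Qed.

Let m_fin A : m A \is a fin_num.
Proof.
rewrite ge0_fin_numE//; apply: (@le_lt_trans _ _ (Phi (fun=> 1))%:E); last exact: ltry.
by apply: le_trans (v_le1 setT); apply: m_leP => //; exact: openT.
Qed.

Lemma outer_content_open G : open G -> m G = v G.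
Proof.
move=> oG; apply/eqP; rewrite eq_le m_leP//=.
by apply: le_ereal_inf_tmp => _ [U [_ GU] <-]; exact: v_le.
Qed.

Let m0 : m set0 = 0%E.
Proof.
rewrite outer_content_open; last exact: open0.
apply/eqP; rewrite eq_le v_ge0 andbT; apply: ge_ereal_sup => _ [f Uf <-].
have -> : f = (fun=> 0) by apply/funext => x; apply: (under_out Uf); exact.
by rewrite Phi0.
Qed.

(** For [f] below the indicator of the union, the sums over [n < k] of the Lipschitz minorants
    [phi n k] of the indicators of [G n], truncated by [f], increase to [f]: one index [k] serves as
    number of sets and as Lipschitz level. The Dini property of [Phi] then compares [Phi f] with a
    finite sum. *)
Let v_bigcup (G : nat -> set T) : (forall n, open (G n)) ->
  (v (\bigcup_n G n) <= \sum_(n <oo) v (G n))%E.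
Proof.
move=> oG; apply: ge_ereal_sup => _ [f Gf <-].
have [Cf _] := Gf; have f0 x : 0 <= f x by case: Gf => _ /(_ x)/andP[].
pose phi n k := lipapx d (\1_(G n)) k.
have Cphi n k : Cb (phi n k) by apply: lipapx_Cb => //; exact: indic_ge0.
have phi0 n k x : 0 <= phi n k x by apply: (lipapx_ge0 dP); exact: indic_ge0.
have phinG n k : under (G n) (phi n k).
  by split => // x; rewrite phi0 (lipapx_le dP)//; exact: indic_ge0.
pose s k x := \sum_(n < k) phi n k x.
have Cs k : Cb (s k) by exact: (Phi_sum k (fun n => Cphi n k)).1.
have sle k x : s k x <= s k.+1 x.
  rewrite /s big_ord_recr/= -[leLHS]addr0; apply: lerD => //.
  by apply: ler_sum => i _; apply: (lipapx_homo dP) => //; exact: indic_ge0.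
pose u k x := f x - Num.min (f x) (s k x).
have Cmin k : Cb (fun x => Num.min (f x) (s k x)) by exact: Cb_min.
have du : decr0 u.
  split; first by move=> k; exact: CbB.
    move=> k x; rewrite /u subr_ge0 ge_min lexx/= lerB//.
    by rewrite le_min !ge_min lexx/= sle orbT.
  move=> x e e0; have [[n _ Gnx]|nG] := pselect ((\bigcup_n G n) x); last first.
    exists 0%N; rewrite /u (under_out Gf nG) /s big_ord0 sub0r minxx oppr0//.
  have [k ke] := lipapx_approx dP (@indic_ge0 (G n)) x (open_indic_lsc (oG n)) e0.
  rewrite indicE mem_set//= in ke.
  (* [K > n] makes [phi n K] one of the summands, and [K >= k] makes it close enough to 1 at [x]. *)
  pose K := maxn n.+1 k; exists K.
  rewrite /u ltrBlDr -ltrBlDl lt_min; apply/andP; split; first lra.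
  apply: (@lt_le_trans _ _ (phi n K x)).
    have := under_in x Gf; have : phi n k x <= phi n K x.
      by apply: (lipapx_homo dP); [exact: indic_ge0|exact: leq_maxr].
    by rewrite /phi; lra.
  rewrite /s (bigD1 (Ordinal (leq_maxl n.+1 k)))//= lerDl.
  by apply: sumr_ge0.
apply/lee_addgt0Pr => e e0; have [_ _ dini] := dPhi.
have [k uk] := dini u e du e0.
have : Phi f <= \sum_(n < k) Phi (phi n k) + e.
  rewrite -(Phi_sum k (fun n => Cphi n k)).2 -/(s k).
  have -> : f = (fun x => Num.min (f x) (s k x) + u k x).
    by apply/funext => x; rewrite /u addrC subrK.
  rewrite PhiD//; last by case: du.
  by apply: lerD; [apply: Phi_le => // x; rewrite ge_min lexx orbT|exact: ltW].
rewrite -lee_fin EFinD => /le_trans; apply; apply: leeD => //.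
rewrite -sumEFin; apply: (@le_trans _ _ (\sum_(n < k) v (G n))%E).
  by apply: lee_sum => n _; exact: v_ge.
rewrite -(big_mkord xpredT (fun n => v (G n))).
by apply: nneseries_lim_ge.
Qed.

Let m_sigma_subadditive : sigma_subadditive m.
Proof.
move=> F; apply/lee_addgt0Pr => e e0.
have ex n : exists G, [/\ open G, F n `<=` G & (v G <= m (F n) + (e / (2 ^ n.+1)%:R)%:E)%E].
  have en : 0 < e / (2 ^ n.+1)%:R by rewrite divr_gt0// ltr0n expn_gt0.
  have [_ [G [oG FG] <-] h] := lb_ereal_inf_adherent en (m_fin (F n)).
  by exists G; split => //; exact: ltW.
have [G GP] := choice ex.
apply: (@le_trans _ _ (v (\bigcup_n G n))).
  apply: m_leP; first by apply: bigcup_open => n _; case: (GP n).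
  by apply: subset_bigcup => n _; case: (GP n).
apply: (le_trans (v_bigcup _)) => [n|]; first by case: (GP n).
apply: le_trans (epsilon_trick xpredT _ (ltW e0)) => //.
by apply: lee_nneseries => [n _ _|n _]; [exact: v_ge0|have [_ _] := GP n].
Qed.

(** Let [U] be open and contain [X], and let [f] lie below the indicator of the intersection of [U]
    and [G]. The part [V] of [U] where [f < r] is open and contains [X \ G], as [f] vanishes off
    [G]. Any [g] under [V] may be added to [(f - r)^+], and cutting off [r] costs at most
    [r * Phi 1 <= e]. *)
Let m_caratheodory G : open G -> forall X, (m (X `&` G) + m (X `&` ~` G) <= m X)%E.
Proof.
move=> oG X; apply: le_ereal_inf_tmp => _ [U [oU XU] <-].
apply: (@le_trans _ _ (v (U `&` G) + m (X `&` ~` G))%E).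
  by apply: leeD => //; apply: m_leP; [exact: openI|move=> x [/XU]].
rewrite -leeBrDr; last exact: m_fin.
apply: ge_ereal_sup => _ [f UGf <-]; rewrite leeBrDr; last exact: m_fin.
apply/lee_addgt0Pr => e e0.
have [Cf _] := UGf; have f0 x : 0 <= f x by case: UGf => _ /(_ x)/andP[].
have Phi1 : 0 <= Phi (fun=> 1) by apply: pos => //; exact: Cb_cst.
pose r := e / (Phi (fun=> 1) + 1).
have r0 : 0 < r by rewrite divr_gt0// ltr_wpDl.
pose V := U `&` [set x | f x < r].
have oV : open V.
  apply: openI => //; apply: (@open_comp _ _ f [set y | y < r]).
    by move=> x _; exact: Cf.1.
  exact: open_lt.
have XV : X `&` ~` G `<=` V.
  move=> x [Xx nGx]; split; first exact: XU.
  by rewrite /= (under_out UGf)// => -[].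
apply: (@le_trans _ _ (v V + (Phi f)%:E)%E).
  by rewrite addeC; apply: leeD => //; exact: m_leP.
rewrite -leeBrDr//; apply: ge_ereal_sup => _ [g Vg <-]; rewrite leeBrDr// -EFinD.
have [Cg _] := Vg; have g0 x : 0 <= g x by case: Vg => _ /(_ x)/andP[].
pose f' x := Num.max (f x - r) 0.
have Cf' : Cb f' by apply: Cb_max; [apply: CbB => //|]; exact: Cb_cst.
(* [(f - r)^+ + g <= 1_U] since [g] vanishes off [V], that is where [f >= r]. *)
have h1 : ((Phi (fun x => (f' x + g x)%R))%:E <= v U)%E.
  apply: v_ge; apply: underP; first exact: CbD.
  - by move=> x; rewrite addr_ge0// /f' le_max lexx orbT.
  - move=> x; rewrite /f'; have f1 := under_in x UGf; have g1 := under_in x Vg.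
    case: (leP (f x - r) 0) => fr; first by rewrite add0r.
    by rewrite (under_out Vg) ?addr0; [lra|move=> [_ /=]; lra].
  - move=> x nUx; rewrite (under_out Vg); last by case.
    by rewrite /f' (under_out UGf) ?addr0; [rewrite sub0r max_r// oppr_le0 ltW|case].
apply: (@le_trans _ _ ((Phi (fun x => (f' x + g x)%R) + e)%:E)); last first.
  by rewrite EFinD; apply: leeD.
rewrite lee_fin PhiD//.
have : Phi f <= Phi f' + r * Phi (fun=> 1).
  have C1 := Cb_cst (T := T) (1 : R); have Cr := CbZ r C1.
  rewrite -(PhiZ r C1) -(PhiD Cf' Cr); apply: Phi_le => //; first exact: CbD.
  by move=> x; rewrite mulr1 /f'; case: (leP (f x - r) 0); lra.
have : r * Phi (fun=> 1) <= e.
  by rewrite /r mulrAC ler_pdivrMr ?ltr_wpDl// ler_pM2l// lerDl.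
by lra.
Qed.

(** Caratheodory's theorem for [m]: its measurable sets contain the open sets by [m_caratheodory],
    hence all Borel sets. *)
Lemma outer_content_measure : exists mu : {measure set (@borelT T) -> \bar R},
  forall A, mu A = m A.
Proof.
pose O := isOuterMeasure.Build R T m m0 m_ge0 m_le m_sigma_subadditive.
pose mo : {outer_measure set T -> \bar R} := HB.pack_for {outer_measure set T -> \bar R} m O.
have sub (A : set (@borelT T)) : measurable A -> mo.-cara.-measurable A.
  move=> mA; have : <<s @open T >> A by [].
  apply: smallest_sub.
    exact: (sigma_algebra_measurable (caratheodory_type mo)).
  by move=> G oG; apply: (@le_caratheodory_measurable _ _ mo); exact: m_caratheodory.
have m_ge0' (A : set (@borelT T)) : (0 <= m A)%E by exact: m_ge0.
have add : semi_sigma_additive (m : set (@borelT T) -> \bar R).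
  move=> F mF tF mbF.
  exact: (@caratheodory_measure_sigma_additive _ _ mo F (fun i => sub _ (mF i)) tF (sub _ mbF)).
pose M := isMeasure.Build _ (@borelT T) R m m0 m_ge0' add.
by exists (HB.pack_for {measure set (@borelT T) -> \bar R} m M).
Qed.

Section Representation.
Variable mu : {measure set (@borelT T) -> \bar R}.
Hypothesis muE : forall A, mu A = m A.

Lemma outer_content_setT : mu setT = (Phi (fun=> 1))%:E.
Proof.
rewrite muE outer_content_open; last exact: openT.
apply/eqP; rewrite eq_le v_le1 v_ge//.
by apply: underP => [|||x /(_ I)]//; exact: Cb_cst.
Qed.

Let muoo : (mu setT < +oo)%E. Proof. by rewrite outer_content_setT ltry. Qed.

Let Eint_cst a : Eint mu (fun=> a) = a * Phi (fun=> 1).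
Proof.
have h : (\int[mu]_x a%:E = a%:E * (Phi (fun=> 1%R))%:E)%E.
  by rewrite (@integral_cst _ _ _ mu setT measurableT a%:E) [mu _]outer_content_setT.
by rewrite /Eint /bf [X in fine X]h.
Qed.

Let mur A := fine (mu A).

Let murE A : mu A = (mur A)%:E.
Proof. by rewrite fineK// muE. Qed.

Let mur_le1 A : mur A <= Phi (fun=> 1).
Proof.
by rewrite -lee_fin -murE -outer_content_setT !muE; exact: m_le.
Qed.

Let open_gt_f f r : Cb f -> open [set x | r < f x].
Proof.
move=> Cf; apply: (@open_comp _ _ f [set y | r < y]); last exact: open_gt.
by move=> x _; exact: Cf.1.
Qed.

(** Markov's inequality with [min f r] in place of [f]: it spends only one slice of height [r], so
    that slices can be summed in [Phi_le_slices]. *)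
Let markov f r : Cb f -> (forall x, 0 <= f x) -> 0 < r ->
  r * mur [set x | r < f x] <= Eint mu (fun x => Num.min (f x) r).
Proof.
move=> Cf f0 r0; have mA := open_measurable_borel (open_gt_f r Cf).
have Cmin : Cb (fun x => Num.min (f x) r) by apply: Cb_min => //; exact: Cb_cst.
rewrite -lee_fin EFinM -murE -(EintE muoo Cmin).
have -> : mu [set x | r < f x] = (\int[mu]_x (\1_[set x | r < f x] x)%:E)%E.
  by rewrite integral_indic// setIT.
have m1 : measurable_fun setT (fun x : @borelT T => (\1_[set x | r < f x] x)%:E : \bar R).
  by apply/measurable_EFinP; exact: measurable_indic.
have i0 (x : @borelT T) : setT x -> (0 <= (\1_[set x | r < f x] x)%:E :> \bar R)%E.
  by move=> _; rewrite lee_fin indic_ge0.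
rewrite -(@ge0_integralZl_EFin _ _ R mu setT measurableT _ i0 m1 r (ltW r0)).
apply: ge0_le_integral => //.
- by move=> x _; rewrite mule_ge0 ?lee_fin ?indic_ge0// ltW.
- by apply: emeasurable_funM => //; exact: measurable_cst.
- by apply/measurable_EFinP; exact: Cb_measurable Cmin.1.
move=> x _; rewrite -EFinM lee_fin indicE /bf.
have [/set_mem/= fr|_] := boolP (x \in _).
  by rewrite mulr1 le_min lexx andbT ltW.
by rewrite mulr0 le_min f0 (ltW r0).
Qed.

(** The bottom slice [f1 = min f r] satisfies [Phi f1 <= r * mu {f > 0}] and, by [markov],
    [r * mu {f > r} <= \int f1]. As [{f > r}] is [{f2 > 0}], the error term of the rest [f2] is
    absorbed by [\int f1], and only that of the bottom slice remains. *)
Let Phi_le_slices N r f : 0 < r -> Cb f -> (forall x, 0 <= f x <= N%:R * r) ->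
  Phi f <= Eint mu f + r * mur [set x | 0 < f x].
Proof.
move=> r0; elim: N f => [|N IH] f Cf fN.
  have -> : f = (fun=> 0).
    by apply/funext => x; apply/eqP; have := fN x; rewrite mul0r eq_le andbC.
  rewrite Phi0 addr_ge0 ?Eint_ge0// mulr_ge0 ?(ltW r0)//.
  by rewrite -lee_fin -murE.
have f0 x : 0 <= f x by have /andP[] := fN x.
pose f1 x := Num.min (f x) r.
have Cf1 : Cb f1 by apply: Cb_min => //; exact: Cb_cst.
pose f2 x := f x - f1 x.
have Cf2 : Cb f2 by exact: CbB.
have f20 x : 0 <= f2 x <= N%:R * r.
  have := fN x; rewrite /f2 /f1 -natr1 mulrDl mul1r subr_ge0 ge_min lexx/= => /andP[_ h].
  case: (leP (f x) r) => fr; last lra.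
  by rewrite subrr mulr_ge0// ltW.
have := IH f2 Cf2 f20.
have -> : [set x | 0 < f2 x] = [set x | r < f x].
  apply/seteqP; split => x /=; rewrite /f2 /f1; case: (leP (f x) r); lra.
have h1 := markov Cf f0 r0; rewrite -/f1 in h1.
have h2 : Eint mu f = Eint mu f1 + Eint mu f2.
  have := Eint_lin muoo (-1) Cf1 Cf; rewrite mulN1r.
  under [X in Eint _ X]eq_fun do rewrite mulN1r addrC.
  by rewrite -/f2; lra.
have h3 : Phi f = Phi f1 + Phi f2 by rewrite /f2 PhiB//; lra.
have h4 : Phi f1 <= r * mur [set x | 0 < f x].
  rewrite -ler_pdivrMl// -PhiZ// -lee_fin -murE muE outer_content_open; last exact: open_gt_f.
  apply: v_ge; apply: underP; first exact: CbZ.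
  - by move=> x; rewrite mulr_ge0 ?invr_ge0 ?(ltW r0)// le_min f0 (ltW r0).
  - by move=> x; rewrite ler_pdivrMl// mulr1 ge_min lexx orbT.
  - move=> x /= /negP; rewrite -leNgt => fx.
    have -> : f1 x = 0; last by rewrite mulr0.
    by apply/eqP; rewrite eq_le ge_min fx/= le_min f0 (ltW r0).
by lra.
Qed.

(** The error in [Phi_le_slices] does not grow with the number of slices, so their height [r] may be
    taken arbitrarily small. *)
Let Phi_le_Eint f : Cb f -> (forall x, 0 <= f x) -> Phi f <= Eint mu f.
Proof.
move=> Cf f0; apply/ler_addgt0Pr => e e0.
have Phi1 : 0 <= Phi (fun=> 1) by apply: pos => //; exact: Cb_cst.
pose r := e / (Phi (fun=> 1) + 1).
have r0 : 0 < r by rewrite divr_gt0// ltr_wpDl.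
have [M M0 fM] := Cb_bound Cf.
apply: (le_trans (@Phi_le_slices (Num.truncn (M / r)).+1 r f r0 Cf _)).
  move=> x; rewrite f0/= -ler_pdivrMr// ltW// (le_lt_trans _ (truncnS_gt _))//.
  by rewrite ler_pM2r ?invr_gt0// (le_trans _ (fM x))// ler_norm.
rewrite lerD2l (le_trans (ler_wpM2l (ltW r0) (mur_le1 _)))//.
by rewrite /r mulrAC ler_pdivrMr ?ltr_wpDl// ler_pM2l// lerDl.
Qed.

(* [Phi f <= \int f] is used for both [M + f] and [M - f]: the total masses agree. *)
Lemma outer_content_integral f : Cb f -> (\int[mu]_x (bf f x)%:E = (Phi f)%:E)%E.
Proof.
move=> Cf; rewrite (EintE muoo Cf); congr _%:E.
have [M M0 fM] := Cb_bound Cf; have CM := Cb_cst (T := T) M.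
have fM' x : - M <= f x <= M by rewrite -ler_norml.
have := Phi_le_Eint (CbD Cf CM) _; have := Phi_le_Eint (CbB CM Cf) _.
rewrite PhiB// PhiD//.
have -> : Eint mu (fun x => M - f x) = M * Phi (fun=> 1) - Eint mu f.
  have := Eint_lin muoo (-1) Cf CM; under [X in Eint _ X]eq_fun do rewrite mulN1r addrC.
  by rewrite Eint_cst mulN1r addrC.
have -> : Eint mu (fun x => f x + M) = Eint mu f + M * Phi (fun=> 1).
  have := Eint_lin muoo 1 Cf CM; under [X in Eint _ X]eq_fun do rewrite mul1r.
  by rewrite Eint_cst mul1r.
have -> : Phi (fun=> M) = M * Phi (fun=> 1).
  by rewrite -(PhiZ _ (Cb_cst 1)); congr Phi; apply/funext => x; rewrite mulr1.
move=> h1 h2; apply/eqP; rewrite eq_le; apply/andP; split.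
  have : M * Phi (fun=> 1) - Phi f <= M * Phi (fun=> 1) - Eint mu f.
    by apply: h1 => x; have := fM' x; lra.
  by lra.
have : Phi f + M * Phi (fun=> 1) <= Eint mu f + M * Phi (fun=> 1).
  by apply: h2 => x; have := fM' x; lra.
by lra.
Qed.

(** Outer approximation, built into [m], is applied to [A] and to its complement. The complement of
    the second open set [G'] is the closed set [F], and [G \ F] is covered by the two small
    differences. *)
Lemma outer_content_regular : regular_measure mu.
Proof.
have outer A e : measurable (A : set (@borelT T)) -> 0 < e ->
    exists G, [/\ open G, A `<=` G & (mu (G `\` A) < e%:E)%E].
  move=> mA e0; have [_ [G [oG AG] <-] h] := lb_ereal_inf_adherent e0 (m_fin A).
  exists G; split => //; have mG := open_measurable_borel oG.
  have : mu G = (mu A + mu (G `\` A))%E.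
    by rewrite (measureDI mu mG mA) setIidr// addeC.
  rewrite -/(m A) -outer_content_open// -!muE (murE A) in h.
  by move=> GA; rewrite GA (murE A) lteD2lE in h.
move=> A mA e e0; have e20 : 0 < e / 2 by rewrite divr_gt0.
have [G [oG AG hG]] := outer A (e / 2) mA e20.
have [G' [oG' AG' hG']] := outer (~` A) (e / 2) (measurableC mA) e20.
exists (~` G'), G; split => //; first by rewrite closedC.
  by move=> x nG'x; apply: contrapT => /AG'.
have mG := open_measurable_borel oG; have mG' := open_measurable_borel oG'.
apply: (@le_lt_trans _ _ (mu (G `\` A) + mu (G' `\` ~` A))%E); last first.
  by rewrite (splitr e) EFinD; exact: lteD.
apply: (@le_trans _ _ (mu ((G `\` A) `|` (G' `\` ~` A)))).
  apply: le_measure; rewrite ?inE;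
    [|by repeat (apply: measurableU || apply: measurableD || apply: measurableC)|].
    by apply: measurableD => //; exact: measurableC.
  move=> x [Gx /= /contrapT G'x]; have [Ax|nAx] := pselect (A x).
    by right; split.
  by left.
by apply: measureU2; [exact: measurableD|apply: measurableD => //; exact: measurableC].
Qed.

End Representation.
End OneForm.

(** Domination on C_b passes through the supremum and the infimum; sets that are null for the
    measure of [Psi] are then null for that of [Phi]. *)
Lemma outer_content_dominated (Phi Psi : (T -> R) -> R) b : 0 < b ->
  (forall f, Cb f -> (forall x, 0 <= f x) -> b * Phi f <= Psi f) ->
  forall A, (b%:E * outer_content Phi A <= outer_content Psi A)%E.
Proof.
move=> b0 PhiPsi A; apply: le_ereal_inf_tmp => _ [G [oG AG] <-].
rewrite -lee_pdivlMl//; apply: (@le_trans _ _ (inner_content Phi G)).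
  by apply: ereal_inf_lbound; exists G.
apply: ge_ereal_sup => _ [f Gf <-]; rewrite lee_pdivlMl//.
apply: (@le_trans _ _ (Psi f)%:E); last by apply: ereal_sup_ubound; exists f.
rewrite -EFinM lee_fin; apply: PhiPsi; first by case: Gf.
by move=> x; case: Gf => _ /(_ x)/andP[].
Qed.

End Riesz.

Section Metrization.
Context {R : realType} {T : ptopologicalType}.

Lemma polish_metrizes : @polish R T -> exists (d : T -> T -> R) (D : set T),
  [/\ metrizes d, countable D & closure D = setT].
Proof.
move=> [[D [cD dD]] [d [[d0 dxx] dsym dtri dop _]]]; exists d, D; split => //.
by split => // x; apply/dxx.
Qed.

End Metrization.

(** * Forms on L^1(c) as Daniell integrals, and a dense sequence *)

Section ContinuousForms.
Context {R : realType} {T : ptopologicalType} (c : (T -> R) -> \bar R).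
Hypothesis cP : capacity c.
Implicit Types (f g X : T -> R) (Phi Psi : (T -> R) -> R).

Lemma contlin_Cb_eq Phi Psi : contlin c Phi -> contlin c Psi ->
  (forall f, Cb f -> Phi f = Psi f) -> forall X, L1 c X -> Phi X = Psi X.
Proof.
move=> cPhi cPsi eqCb X LX.
have := contlin_lin cP (-1) cPsi cPhi => /(contlin_blin cP)[K K0 [lin bd]].
apply/eqP; rewrite -subr_eq0 -normr_le0; apply/ler_addgt0Pr => e e0; rewrite add0r.
have [f Cf Xf] := csn_dense cP LX (divr_gt0 e0 K0).
have Lf := L1_Cb cP Cf; have := bd _ (L1B cP LX Lf).
rewrite (linL1B lin)//= (eqCb f Cf) !mulN1r [- Psi f + _]addrC subrr subr0 addrC => h.
by rewrite (le_trans h)// mulrC -ler_pdivlMr// ltW.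
Qed.

Lemma contlin_daniell Phi : contlin c Phi -> nonneg_form c Phi -> daniell Phi.
Proof.
move=> cPhi pPhi; split.
- by move=> a f g Cf Cg; apply: cPhi.1; exact: L1_Cb.
- by move=> f Cf f0; apply: pPhi; exact: nonnegL_Cb.
- move=> u e du e0; have [K K0 [_ bd]] := contlin_blin cP cPhi.
  have [n ne] := csn_decr0 cP du (divr_gt0 e0 K0); exists n.
  have Lu : L1 c (u n) by apply: L1_Cb => //; case: du.
  rewrite (le_lt_trans (ler_norm _))// (le_lt_trans (bd _ Lu))//.
  by rewrite mulrC -ltr_pdivlMr.
Qed.

Lemma contlin_null Phi X : contlin c Phi -> L1 c X -> c X = 0%E -> Phi X = 0.
Proof.
move=> /(contlin_blin cP)[K _ [_ bd]] LX cX; apply/eqP; rewrite -normr_le0.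
by have := bd X LX; rewrite /csn cX mulr0.
Qed.

Lemma represents_nonneg (mu : {measure set (@borelT T) -> \bar R}) Phi :
  represents c mu Phi -> nonneg_form c Phi.
Proof.
move=> [cPhi muPhi]; apply: (nonneg_form_Cb cP cPhi) => f Cf f0.
by rewrite -lee_fin -muPhi//; apply: integral_ge0 => x _; rewrite lee_fin.
Qed.

(** Minorants approximate only non-negative functions, so [f] is written as [(f + M) - M] and both
    terms are approximated, the constant too; differences of two minorants form a countable
    family. *)
Lemma separating_sequence (d : T -> T -> R) (D : set T) : metrizes d ->
  countable D -> closure D = setT -> exists F : nat -> T -> R,
  (forall n, Cb (F n)) /\
  forall f e, Cb f -> 0 < e -> exists n, csn c (fun x => f x - F n x) < e.
Proof.
move=> dP cD dD; have [a aP] := dense_sequence dP cD dD.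
pose F n : T -> R := let: (i, j) := odflt (0%N, 0%N) (unpickle n) in
  fun x => minorant d a i x - minorant d a j x.
have Cm i : Cb (minorant d a i) by exact: minorant_Cb.
exists F; split.
  by move=> n; rewrite /F; case: (odflt _ _) => i j; exact: CbB.
move=> f e Cf e0; have e20 : 0 < e / 2 by rewrite divr_gt0.
have [M M0 fM] := Cb_bound Cf; have CM := Cb_cst (T := T) M.
have CfM := CbD Cf CM.
have fM0 x : 0 <= f x + M.
  by have := fM x; rewrite ler_norml => /andP[h _]; lra.
have [g1 dg1] := minorant_approx dP aP CfM fM0.
have [g2 dg2] := minorant_approx dP aP CM (fun=> ltW M0).
have [n ne] := csn_decr0 cP dg1 e20; have [m me] := csn_decr0 cP dg2 e20.
exists (pickle (g1 n, g2 m)); rewrite /F pickleK/=.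
have -> : (fun x => f x - (minorant d a (g1 n) x - minorant d a (g2 m) x)) =
  (fun x => (f x + M - minorant d a (g1 n) x) - (M - minorant d a (g2 m) x)).
  by apply/funext => x; ring.
have L1' := L1_Cb cP (CbB CfM (Cm (g1 n))).
have L2' := L1_Cb cP (CbB CM (Cm (g2 m))).
have L0 := L1_Cb cP (Cb_cst (T := T) 0).
have := csn_dist_triangle cP L1' L2' L0.
under [X in _ <= csn c X + _]eq_fun do rewrite subr0.
rewrite [X in _ <= _ + X](csn_distC cP).
under [X in _ <= _ + csn c X]eq_fun do rewrite subr0.
lra.
Qed.

End ContinuousForms.

(** * Expectations as forms, and the null non-negative elements *)

Section CapacityOfMeasures.
Context {R : realType} {T : ptopologicalType} (d : T -> T -> R) (p : R).
Variable Ps : set (probability (@borelT T) R).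
Hypotheses (dP : metrizes d) (p1 : 1 <= p) (Ps0 : Ps !=set0).
Hypothesis cPs : weakly_rel_compact Ps.

Local Notation c := (cap Ps p).

Lemma capacity_cap : capacity c.
Proof.
split.
- exact: cap_ge0.
- exact: cap_le.
- exact: capZ_le.
- exact: (capD dP).
- exact: cap_Cb_lty.
- by move=> u e; exact: cap_decr0.
Qed.

Let cP := capacity_cap.

Lemma nrm_le_csn mu f : Cb f -> Ps mu -> nrm p mu f <= csn c f.
Proof.
move=> Cf Pmu; rewrite -lee_fin -(L1_csn cP (L1_Cb cP Cf)) cap_Cb//.
exact: cCb_ge.
Qed.

Lemma csn_le_nrm f M : Cb f -> (forall mu, Ps mu -> nrm p mu f <= M) -> csn c f <= M.
Proof.
move=> Cf h; rewrite -lee_fin -(L1_csn cP (L1_Cb cP Cf)) cap_Cb//.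
by apply/cCb_leP => // mu Pmu; rewrite lee_fin; exact: h.
Qed.

(** [|E(f)|] is at most the L^p norm, hence at most [c f], so the expectation extends from C_b to
    [L1] with bound 1. *)
Lemma expectation_form mu : Ps mu -> exists Phi,
  [/\ blin c 1 Phi, nonneg_form c Phi & forall f, Cb f -> Phi f = Eint mu f].
Proof.
move=> Pmu; have muoo : (mu setT < +oo)%E by rewrite probability_setT ltry.
have [Phi bPhi PhiE] : exists2 Phi, blin c 1 Phi & forall f, Cb f -> Phi f = Eint mu f.
  apply: (blin_Cb_extension cP ler01) => [a f g|f Cf]; first exact: Eint_lin.
  by rewrite mul1r (le_trans (Eint_le_nrm p1 mu Cf))// nrm_le_csn.
exists Phi; split => //; apply: (nonneg_form_Cb cP (blin_contlin cP bPhi)).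
by move=> f Cf f0; rewrite PhiE//; exact: Eint_ge0.
Qed.

(** The expectations are among the forms [Phi]. For [f] in C_b near [X], each [mu] in [Ps] gives [f]
    a norm of at most [3 * e / 4]: [e / 4] for [h = min f g], which is bounded with small
    expectation, and [e / 2] for [f - h], dominated by [|f - g|] where both functions are near
    [X]. *)
Lemma cap_eq0 X : nonnegL c X ->
  (forall Phi, contlin c Phi -> nonneg_form c Phi -> Phi X = 0) -> c X = 0%E.
Proof.
move=> pX PhiX; have LX := pX.1; rewrite (L1_csn cP LX); congr _%:E.
apply/eqP; rewrite eq_le csn_ge0// andbT; apply/ler_addgt0Pr => e e0; rewrite add0r.
have e40 : 0 < e / 4 by rewrite divr_gt0.
have [f [Cf f0 Xf]] := nonnegL_approx cP pX e40.
have Lf := L1_Cb cP Cf; have [K K0 fK] := Cb_bound Cf.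
have csf : csn c f <= 3 * (e / 4).
  apply: csn_le_nrm => // mu Pmu.
  have muoo : (mu setT < +oo)%E by rewrite probability_setT ltry.
  have [r r0 small] := nrm_small p1 mu K0 e40.
  have re0 : 0 < Num.min r (e / 4) by rewrite lt_min r0.
  (* A second approximation of [X]: the precision [r] depends on the bound [K] of [f], so [f] had to
     be fixed first. *)
  have [g [Cg g0]] := nonnegL_approx cP pX re0; rewrite lt_min => /andP[Xg1 Xg2].
  have Lg := L1_Cb cP Cg.
  have [Phi [bPhi pPhi PhiE]] := expectation_form Pmu.
  have Eg : Eint mu g <= r.
    rewrite -PhiE//; have := bPhi.2 _ (L1B cP LX Lg).
    rewrite (linL1B bPhi.1)// (PhiX _ (blin_contlin cP bPhi) pPhi) sub0r normrN mul1r.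
    by move=> /(le_trans (ler_norm _)) /le_trans; apply; exact: ltW.
  pose h x := Num.min (f x) (g x).
  have Ch : Cb h by exact: Cb_min.
  have nh : nrm p mu h <= e / 4.
    apply: small => //.
      move=> x; rewrite le_min f0 g0 ge_min.
      by rewrite (le_trans (ler_norm _) (fK x)).
    by apply: (le_trans _ Eg); apply: (Eint_le muoo) => // x; rewrite ge_min lexx orbT.
  have nfh : nrm p mu (fun x => f x - h x) <= e / 4 + e / 4.
    apply: (@le_trans _ _ (nrm p mu (fun x => f x - g x))).
      apply: nrm_le => //; [exact: CbB|exact: CbB|].
      move=> x; rewrite /h; case: (leP (f x) (g x)) => //.
      by rewrite subrr normr0.
    apply: (le_trans (nrm_le_csn (CbB Cf Cg) Pmu)).
    have := csn_dist_triangle cP Lf Lg LX; rewrite (csn_distC cP f X); lra.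
  have fE : f = (fun x => h x + (f x - h x)) by apply/funext => x; rewrite addrC subrK.
  rewrite [in leLHS]fE; apply: (le_trans (nrmD p1 mu Ch (CbB Cf Ch))).
  have -> : 3 * (e / 4) = e / 4 + (e / 4 + e / 4) by ring.
  exact: lerD nh nfh.
have := csnD cP (L1B cP LX Lf) Lf.
by under [X in csn c X <= _ -> _]eq_fun do rewrite subrK; lra.
Qed.

End CapacityOfMeasures.

Section RepresentingMeasures.
Context {R : realType} {T : ptopologicalType} (d : T -> T -> R).
Variable c : (T -> R) -> \bar R.
Hypotheses (dP : metrizes d) (cP : capacity c).

Lemma represents_outer_content Phi : contlin c Phi -> nonneg_form c Phi ->
  exists mu : {measure set (@borelT T) -> \bar R},
    (forall A, mu A = outer_content Phi A) /\ represents c mu Phi.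
Proof.
move=> cPhi pPhi; have dPhi := contlin_daniell cP cPhi pPhi.
have [mu muE] := outer_content_measure dP dPhi.
by exists mu; split => //; split => // f; exact: (outer_content_integral dPhi muE).
Qed.

Lemma represents_Mplus (mu : {measure set (@borelT T) -> \bar R}) Phi :
  represents c mu Phi -> Mplus c mu.
Proof.
move=> rPhi; split; last by exists Phi.
have := rPhi.2 _ (Cb_cst (1 : R)).
by rewrite /bf (@integral_cst _ _ _ mu setT measurableT 1%E) mul1e => ->; rewrite ltry.
Qed.

Lemma represents_Cb_eq (mu : {measure set (@borelT T) -> \bar R}) Phi Psi X :
  represents c mu Phi -> represents c mu Psi -> L1 c X -> Phi X = Psi X.
Proof.
move=> [cPhi muPhi] [cPsi muPsi]; apply: (contlin_Cb_eq cP cPhi cPsi) => f Cf.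
by apply: EFin_inj; rewrite -muPhi// -muPsi.
Qed.

End RepresentingMeasures.

(* [mnormalize] serves to package a measure of mass one as a [probability]. *)
Lemma mnormalize_mass1 {disp} {T : measurableType disp} {R : realType}
  (mu : {measure set T -> \bar R}) (P : probability T R) :
  mu setT = 1%E -> forall A, mnormalize mu P A = mu A.
Proof.
move=> mu1 A; rewrite /mnormalize mu1.
rewrite (_ : (1%E == 0%E :> \bar R) || (1%E == +oo%E :> \bar R) = false).
  by rewrite invr1 mule1.
by rewrite eqe oner_eq0.
Qed.

(** * The measure [P] and the dense sequence of forms *)

Theorem theorem4p14 (R : realType) (T : ptopologicalType)
  (HT : @polish R T)
  (Ps : set (probability (@borelT T) R)) (HPs0 : Ps !=set0)
  (HPs : weakly_rel_compact Ps)
  (p : R) (hp : 1 <= p) :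
  let c := cap Ps p in
  exists (P : probability (@borelT T) R) (PhiP : (T -> R) -> R)
         (L : nat -> (T -> R) -> R),
    [/\ (* P is a regular Borel probability measure in the canonical c_p-class;
           PhiP is the continuous linear form X |-> P(X) *)
        (regular_measure P /\ canonical_class c P /\ represents c P PhiP),
        (* L^1(c_p)^*_+ = M^+(c_p) *)
        ((forall Phi, contlin c Phi -> nonneg_form c Phi ->
           exists mu : {measure set (@borelT T) -> \bar R},
             Mplus c mu /\ represents c mu Phi) /\
        (forall (mu : {measure set (@borelT T) -> \bar R}) Phi,
           Mplus c mu -> represents c mu Phi -> nonneg_form c Phi)),
        (* D = {L_n} is weak*-dense in L^1(c_p)^*_+ *)
        ((forall Phi, contlin c Phi -> nonneg_form c Phi ->
           forall (k : nat) (X : nat -> T -> R), (forall i, (i < k)%N -> L1 c (X i)) ->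
           forall e, 0 < e -> exists n, forall i, (i < k)%N ->
             `|L n (X i) - Phi (X i)| < e) /\
        (* each L_n is in L^1(c_p)^*_+ and is represented by a non-negative measure << P *)
        (forall n, contlin c (L n) /\ nonneg_form c (L n) /\
           exists mu : {measure set (@borelT T) -> \bar R},
             (mu `<< P) /\ represents c mu (L n))),
        (* every continuous linear form is a weak* limit of differences in D *)
        (forall Phi, contlin c Phi -> exists a b : nat -> nat,
           forall X, L1 c X ->
             (fun n => L (a n) X - L (b n) X) @ \oo --> Phi X) &
        (* characterisation of null non-negative elements *)
        (forall X, nonnegL c X ->
           (c X = 0%E <-> PhiP X = 0) /\ (PhiP X = 0 <-> forall n, L n X = 0))].
Proof.
move=> c; have [d [D [dP cD dD]]] := polish_metrizes HT.
have cP : capacity c := capacity_cap dP hp HPs0 HPs.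
have [F [CF Fdense]] := separating_sequence cP dP cD dD.
have [L [LP Ldense]] := countable_family cP CF Fdense.
have [Psi [b [cPsi b0 bPsi]]] := dominating_form cP LP.
have L1one : L1 c (fun=> 1) by exact/(L1_Cb cP)/Cb_cst.
have pone : nonnegL c (fun=> 1) by apply: (nonnegL_Cb cP) => //; exact: Cb_cst.
have [P0 PsP0] := HPs0.
(* Normalization requires [Psi 1 > 0]: an expectation has value 1 at the constant 1, so some
   [L (a n)] is positive there. *)
have Psi1 : 0 < Psi (fun=> 1).
  have [E [bE pE EE]] := expectation_form dP hp HPs0 HPs PsP0.
  have [a aE] := Ldense E (blin_contlin cP bE) pE.
  have := aE _ L1one; rewrite EE; last exact: Cb_cst.
  rewrite Eint_cst => /cvgrPdist_lt /(_ 1 ltr01) [n _ /(_ n (leqnn n))] /=.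
  rewrite ltr_norml => /andP[_ h].
  apply: (@lt_le_trans _ _ (b (a n) * L (a n) (fun=> 1))).
    by rewrite mulr_gt0//; lra.
  by apply: bPsi => // k; apply: (LP k).2.
(* The summand 0 gives [PhiP] the shape expected by [contlin_lin], with the zero form as second
   form. *)
pose PhiP X := (Psi (fun=> 1))^-1 * Psi X + 0.
have b'0 n : 0 < (Psi (fun=> 1))^-1 * b n by rewrite mulr_gt0// invr_gt0.
have PhiP_ge n X : (forall k, 0 <= L k X) -> L1 c X ->
    (Psi (fun=> 1))^-1 * b n * L n X <= PhiP X.
  move=> LX0 LX; rewrite /PhiP addr0 -mulrA ler_pM2l ?invr_gt0//.
  exact: bPsi.
have zlin : contlin c (fun=> 0).
  apply: (@blin_contlin _ _ _ cP 0); split => *; by rewrite ?mulr0 ?addr0 ?normr0 ?mul0r.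
have cPhiP : contlin c PhiP by exact: contlin_lin.
have LCb k f : Cb f -> (forall x, 0 <= f x) -> 0 <= L k f.
  by move=> Cf f0; apply: (LP k).2; exact: nonnegL_Cb.
have pPhiP : nonneg_form c PhiP.
  apply: (nonneg_form_Cb cP cPhiP) => f Cf f0.
  apply: le_trans (PhiP_ge 0%N f (fun k => LCb k f Cf f0) (L1_Cb cP Cf)).
  by rewrite mulr_ge0// ?LCb// ltW.
have dPhiP := contlin_daniell cP cPhiP pPhiP.
have [mu [muE [_ muPhi]]] := represents_outer_content dP cP cPhiP pPhiP.
have mu1 : mu setT = 1%E.
  by rewrite (outer_content_setT dPhiP muE) /PhiP addr0 mulVf ?gt_eqF.
pose P : probability (@borelT T) R := mnormalize mu P0.
have PE A : P A = mu A by exact: mnormalize_mass1.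
have repP : represents c P PhiP.
  split => // f Cf; rewrite -muPhi//; apply: eq_measure_integral => A _ _.
  exact: PE.
have PhiL n X : nonnegL c X -> PhiP X = 0 -> L n X = 0.
  move=> pX PX0; have LX0 k : 0 <= L k X by exact: (LP k).2.
  apply/eqP; rewrite eq_le LX0 andbT -(pmulr_rle0 _ (b'0 n)) -PX0.
  exact: PhiP_ge pX.1.
(* If all [L n] vanish at [X], so does every non-negative form, as a weak* sequential limit of some
   of them; [cap_eq0] concludes. *)
have L_dense0 X : nonnegL c X -> (forall n, L n X = 0) -> c X = 0%E.
  move=> pX LX0; apply: (cap_eq0 dP hp HPs0 HPs pX) => Phi cPhi pPhi.
  have [a /(_ X pX.1)] := Ldense Phi cPhi pPhi.
  under eq_fun do rewrite LX0.
  by move=> /(cvg_lim (@Rhausdorff R)) <-; rewrite lim_cst.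
have cPhi0 X : nonnegL c X -> c X = 0%E -> PhiP X = 0.
  by move=> pX; apply: (contlin_null cP cPhiP pX.1).
exists P, PhiP, L; split.
- split; [|split => //; split].
  + exact: (outer_content_regular dPhiP (fun A => etrans (PE A) (muE A))).
  + exact: represents_Mplus repP.
  + move=> Phi repPhi X pX; rewrite (represents_Cb_eq cP repPhi repP pX.1).
    split => [PX0|]; last exact: cPhi0.
    by apply: L_dense0 => // n; exact: PhiL.
- split.
    move=> Phi cPhi pPhi; have [nu [_ repnu]] := represents_outer_content dP cP cPhi pPhi.
    by exists nu; split => //; exact: represents_Mplus repnu.
  by move=> nu Phi _; exact: represents_nonneg.
- split.
    move=> Phi cPhi pPhi k X LX e e0; have [a aP] := Ldense Phi cPhi pPhi.
    suff [N NP] : exists N, forall n, (N <= n)%N -> forall i, (i < k)%N ->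
        `|L (a n) (X i) - Phi (X i)| < e by exists (a N); exact: NP.
    elim: k LX => [|k IH] LX; first by exists 0%N.
    have [|N NP] := IH; first by move=> i ik; apply: LX; exact: ltnW.
    have /cvgrPdist_lt /(_ e e0) [M _ MP] := aP _ (LX k (ltnSn k)).
    exists (maxn N M) => n; rewrite geq_max => /andP[Nn Mn] i.
    rewrite ltnS leq_eqVlt => /predU1P[->|]; last exact: NP.
    by rewrite distrC; exact: MP.
  move=> n; have [cL pL] := LP n; split => //; split => //.
  have [nu [nuE repnu]] := represents_outer_content dP cP cL pL.
  exists nu; split => // N N0 A mA AN; have := N0 A mA AN.
  rewrite PE muE nuE => PA0.
  (* [nu] and [P] are the outer contents of [L n] and [PhiP], and a positive multiple of [L n] is
     dominated by [PhiP]; hence [nu A] vanishes with [P A]. *)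
  have := @outer_content_dominated _ _ (L n) PhiP _ (b'0 n) _ A.
  rewrite PA0 => /(_ _)/wrap[|h].
    by move=> f Cf f0; apply: PhiP_ge => [k|]; [exact: LCb|exact: L1_Cb].
  apply/eqP; rewrite eq_le -{2}nuE measure_ge0 andbT.
  by move: h; rewrite -lee_pdivlMl// mule0.
- move=> Phi cPhi; have [Psi1' [Psi2 [[c1 p1] [c2 p2] PhiE]]] := contlin_decomposition cP cPhi.
  have [a1 a1P] := Ldense _ c1 p1; have [a2 a2P] := Ldense _ c2 p2.
  exists a1, a2 => X LX; rewrite PhiE.
  by apply: cvgB; [exact: a1P|exact: a2P].
- move=> X pX; split; split.
  + exact: cPhi0.
  + by move=> PX0; apply: L_dense0 => // n; exact: PhiL.
  + by move=> PX0 n; exact: PhiL.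
  + by move=> LX0; apply: cPhi0 => //; exact: L_dense0.
Qed.
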